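(* Assume the complete theory $T$ is $\mathrm{NTP}_2$, with monster model $\mathcal{U}$. Given $p\in S_x(\mathcal{U})$ and a small model $M\prec\mathcal{U}$, the following are equivalent: (i) $p$ is generically stable over $M$; (ii) $p$ is weakly stationary over $M$ and, for any $a\models p|_M$ and any tuple $b$ from $\mathcal{U}$, if $b\mathop{\smile\!\!\!\!\!\!|}_M a$ then $a\mathop{\smile\!\!\!\!\!\!|}_M b$.
   Context: $\mathop{\smile\!\!\!\!\!\!|}$ denotes nonforking independence ($a\mathop{\smile\!\!\!\!\!\!|}_M b$ means $\operatorname{tp}(a/Mb)$ does not fork over $M$). $p$ is weakly stationary over $M$ if $p$ is the unique global extension of $p|_M$ that does not fork over $M$. $p$ is $M$-invariant if $\phi(x;b)\in p\iff\phi(x;b')\in p$ whenever $b\equiv_M b'$. A Morley sequence in an $M$-invariant $p$ over $M$ is $(a_i)_{i<\alpha}$ with $a_i\models p|_{M\cup\{a_j:j<i\}}$; $\operatorname{Av}(a_i)_{i<\alpha}$ is the set of $\mathcal{L}(\mathcal{U})$-formulas $\phi(x)$ with $\{i<\alpha:\models\neg\phi(a_i)\}$ finite. $p$ is generically stable over $M$ if $p$ is $M$-invariant and $\operatorname{Av}(a_i)_{i<\alpha}$ is a complete type for every Morley sequence $(a_i)_{i<\alpha}$ in $p$ over $M$ and every infinite ordinal $\alpha$. *)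

(* Defs.v *)
From mathcomp Require Import all_boot all_classical.

Set Implicit Arguments.
Unset Strict Implicit.
Unset Printing Implicit Defensive.

Local Open Scope classical_set_scope.

Record language := Language {
  funs : Type;
  rels : Type;
  fun_ar : funs -> nat;
  rel_ar : rels -> nat }.

(* The free variables of [term L V] and [formula L V] are indexed by an
   arbitrary type V; a quantifier binds the variable [None] of [option V]. *)
Inductive term (L : language) (V : Type) : Type :=
  | Var of V
  | App (f : funs L) of ('I_(fun_ar f) -> term L V).

Inductive formula (L : language) (V : Type) : Type :=
  | Bot
  | Eq of term L V & term L V
  | Rel (r : rels L) of ('I_(rel_ar r) -> term L V)
  | Imp of formula L V & formula L V
  | All of formula L (option V).

Arguments Bot {L V}.

Definition Neg L V (phi : formula L V) : formula L V := Imp phi Bot.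

Fixpoint trename L V W (s : V -> W) (t : term L V) : term L W :=
  match t with
  | Var v => Var L (s v)
  | App f ts => App (fun i => trename s (ts i))
  end.

Fixpoint rename L V W (s : V -> W) (phi : formula L V) : formula L W :=
  match phi with
  | Bot => Bot
  | Eq t u => Eq (trename s t) (trename s u)
  | Rel r ts => Rel (fun i => trename s (ts i))
  | Imp phi1 phi2 => Imp (rename s phi1) (rename s phi2)
  | All phi1 => All (rename (omap s) phi1)
  end.

Record structure (L : language) := Structure {
  carrier :> Type;
  carrier_inh : inhabited carrier;
  fun_interp : forall f : funs L, ('I_(fun_ar f) -> carrier) -> carrier;
  rel_interp : forall r : rels L, ('I_(rel_ar r) -> carrier) -> Prop }.

Fixpoint eval L (N : structure L) V (e : V -> N) (t : term L V) : N :=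
  match t with
  | Var v => e v
  | App f ts => fun_interp (fun i => eval e (ts i))
  end.

Fixpoint sat L (N : structure L) V (e : V -> N) (phi : formula L V) : Prop :=
  match phi with
  | Bot => False
  | Eq t u => eval e t = eval e u
  | Rel r ts => rel_interp (fun i => eval e (ts i))
  | Imp phi1 phi2 => sat e phi1 -> sat e phi2
  | All phi1 => forall x : N, sat (oapp e x) phi1
  end.

Definition join A B C (f : A -> C) (g : B -> C) (v : A + B) : C :=
  match v with inl a => f a | inr b => g b end.

Definition sentence (L : language) := formula L void.
Definition theory (L : language) := set (sentence L).

Definition models L (N : structure L) (T : theory L) : Prop :=
  forall s, T s -> sat (of_void N) s.

Definition entails L (T : theory L) (s : sentence L) : Prop :=
  forall N : structure L, models N T -> sat (of_void N) s.

Definition complete_theory L (T : theory L) : Prop :=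
  (exists N : structure L, models N T) /\
  (forall s, entails T s \/ entails T (Neg s)).

Section InStructure.
Variables (L : language) (U : structure L).

(* An L(U)-formula in variables X: the constants naming elements of U are
   represented by the right summand of the index type of the variables. *)
Definition lformula (X : Type) := formula L (X + U).

Definition holds X (a : X -> U) (phi : lformula X) : Prop :=
  sat (join a id) phi.

(* [inst phi b] is phi(x; b), for phi(x; y) without parameters. *)
Definition inst X n (phi : formula L (X + 'I_n)) (b : 'I_n -> U) :
    lformula X :=
  rename (join inl (inr \o b)) phi.

Definition over X (A : set U) (phi : lformula X) : Prop :=
  exists n (psi : formula L (X + 'I_n)) (b : 'I_n -> U),
    (forall i, A (b i)) /\ phi = inst psi b.

(* Finite satisfiability in U, i.e. consistency with the elementary diagram
   of U. *)
Definition lconsistent X (s : set (lformula X)) : Prop :=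
  forall F, finite_set F -> F `<=` s ->
    exists a : X -> U, forall phi, F phi -> holds a phi.

(* S_x(A) *)
Definition is_type X (A : set U) (p : set (lformula X)) : Prop :=
  [/\ p `<=` over A, lconsistent p &
      forall phi, over A phi -> p phi \/ p (Neg phi)].

Definition tp X (a : X -> U) (A : set U) : set (lformula X) :=
  [set phi | over A phi /\ holds a phi].

Definition restr X (p : set (lformula X)) (A : set U) : set (lformula X) :=
  p `&` over A.

Definition realizes X (a : X -> U) (p : set (lformula X)) : Prop :=
  forall phi, p phi -> holds a phi.

End InStructure.

(* The universe of an elementary substructure. *)
Section Elementary.
Variables (L : language) (U : structure L) (M : set U).

Definition fun_closed : Prop :=
  forall (f : funs L) (u : 'I_(fun_ar f) -> U),
    (forall i, M (u i)) -> M (fun_interp u).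

Definition induced (Minh : inhabited {u | M u}) (Mcl : fun_closed) :
    structure L :=
  @Structure L {u | M u} Minh
    (fun f u => exist M (fun_interp (fun i => sval (u i)))
                      (Mcl f _ (fun i => svalP (u i))))
    (fun r u => rel_interp (fun i => sval (u i))).

Definition elementary_substructure : Prop :=
  exists (Minh : inhabited {u | M u}) (Mcl : fun_closed),
    forall n (phi : formula L 'I_n) (e : 'I_n -> induced Minh Mcl),
      sat e phi <-> sat (fun i => sval (e i) : U) phi.

End Elementary.

(* Cardinals are represented by types: |I| < |K|. *)
Definition small (K I : Type) : Prop :=
  ([set: I] #<= [set: K])%card /\ ~ ([set: K] #<= [set: I])%card.

Definition automorphism L (U : structure L) (s : U -> U) : Prop :=
  [/\ bijective s,
      forall (f : funs L) (u : 'I_(fun_ar f) -> U),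
        s (fun_interp u) = fun_interp (s \o u) &
      forall (r : rels L) (u : 'I_(rel_ar r) -> U),
        rel_interp u <-> rel_interp (s \o u)].

Definition saturated L (K : Type) (U : structure L) : Prop :=
  forall A : set U, small K {u | A u} ->
  forall s : set (lformula U unit), s `<=` over A -> lconsistent s ->
  exists a, realizes a s.

(* A tuple and its image under a partial elementary map are two tuples with
   the same type over the empty set. *)
Definition strongly_homogeneous L (K : Type) (U : structure L) : Prop :=
  forall I : Type, small K I ->
  forall a b : I -> U, tp a set0 = tp b set0 ->
  exists2 s, automorphism s & s \o a = b.

(* U is |K|-saturated and strongly |K|-homogeneous, with |K| > |L| + aleph_0;
   "small" means of cardinality less than |K|. *)
Definition monster L (K : Type) (T : theory L) (U : structure L) : Prop :=
  [/\ [/\ small K nat, small K (funs L) & small K (rels L)],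
      models U T, saturated K U & strongly_homogeneous K U].

(* The set of instances phi(x; b_i), for i in I, is k-inconsistent. *)
Definition k_inconsistent L (U : structure L) X n (k : nat)
    (phi : formula L (X + 'I_n)) (b : nat -> 'I_n -> U) : Prop :=
  forall i : 'I_k -> nat, injective i ->
    ~ exists a : X -> U, forall j, holds a (inst phi (b (i j))).

Definition has_TP2 L (N : structure L) n m (phi : formula L ('I_n + 'I_m)) :
    Prop :=
  exists (k : nat) (b : nat -> nat -> 'I_m -> N),
    (forall i, k_inconsistent k phi (b i)) /\
    (forall f : nat -> nat,
       lconsistent [set inst phi (b i (f i)) | i in [set: nat]]).

Definition NTP2 L (T : theory L) : Prop :=
  forall N : structure L, models N T ->
  forall n m (phi : formula L ('I_n + 'I_m)), ~ has_TP2 N phi.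

Section Independence.
Variables (L : language) (U : structure L).

Definition divides X (A : set U) (psi : lformula U X) : Prop :=
  exists n (phi : formula L (X + 'I_n)) (b : 'I_n -> U),
    psi = inst phi b /\
    exists (k : nat) (c : nat -> 'I_n -> U),
      (forall i, tp (c i) A = tp b A) /\ k_inconsistent k phi c.

Definition forks X (A : set U) (psi : lformula U X) : Prop :=
  exists F : set (lformula U X),
    [/\ finite_set F, F `<=` divides A &
        forall a : X -> U, holds a psi -> exists2 phi, F phi & holds a phi].

(* Used for complete types only; these are closed under finite
   conjunctions. *)
Definition type_forks X (A : set U) (p : set (lformula U X)) : Prop :=
  exists2 psi, p psi & forks A psi.

(* a is independent from b over M. *)
Definition indep X Y (M : set U) (a : X -> U) (b : Y -> U) : Prop :=
  ~ type_forks M (tp a (M `|` range b)).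

Definition weakly_stationary X (M : set U) (p : set (lformula U X)) : Prop :=
  ~ type_forks M p /\
  forall q : set (lformula U X), is_type setT q -> restr p M `<=` q ->
    ~ type_forks M q -> q = p.

Definition invariant X (M : set U) (p : set (lformula U X)) : Prop :=
  forall n (phi : formula L (X + 'I_n)) (b b' : 'I_n -> U),
    tp b M = tp b' M -> (p (inst phi b) <-> p (inst phi b')).

Definition strict_well_order I (lt : I -> I -> Prop) : Prop :=
  [/\ well_founded lt,
      forall i j k, lt i j -> lt j k -> lt i k &
      forall i j, [\/ lt i j, i = j | lt j i]].

Definition morley_sequence X (M : set U) (p : set (lformula U X))
    I (lt : I -> I -> Prop) (a : I -> X -> U) : Prop :=
  forall i, realizes (a i)
    (restr p (M `|` [set u | exists2 j, lt j i & range (a j) u])).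

Definition Av X I (a : I -> X -> U) : set (lformula U X) :=
  [set phi | finite_set [set i | holds (a i) (Neg phi)]].

(* An infinite ordinal is represented by an infinite type with a strict
   well-order. *)
Definition generically_stable X (M : set U) (p : set (lformula U X)) : Prop :=
  invariant M p /\
  forall I (lt : I -> I -> Prop), strict_well_order lt ->
    infinite_set [set: I] ->
  forall a : I -> X -> U, morley_sequence M p lt a -> is_type setT (Av a).

End Independence.

(* Main.v *)
(** A global type is handled as an ultrafilter on the set of tuples of U, a type
    finitely satisfiable in M as one concentrating on the tuples of M.

    (i) => (ii). If b satisfies R(e_i, b) for arbitrarily long Morley sequences
    (e_i) of p while p contains ~R(x, b), then some b' satisfies R along an
    infinite Morley sequence which, continued over b', has order type
    omega + omega and an average that is not complete. This makes failures of
    symmetry divide along Morley sequences, and it excludes a nonforking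
    extension q <> p: if c realizes q over a Morley sequence of p, then
    symmetry allows c to be inserted in front of it.

    (ii) => (i). A coheir of p|M does not fork over M, so p is itself finitely
    satisfiable in M. If Av is not complete, some b satisfies phi(a_i, b) along
    a Morley sequence (a_i) of p while p contains ~phi(x, b). It suffices that
    tp(b/M) + phi(a_0, y) does not fork over M: a nonforking realization b' is
    independent from a_0, hence a_0 realizes p over b', contradicting
    phi(a_0, b'). By NTP2, a formula dividing over M is inconsistent along the
    Morley sequences of some coheir (extending Kim's lemma); a version of the
    broom lemma of Chernikov and Kaplan then turns an implication
    alpha(y, a_0) |- disjunction of dividing formulas into the inconsistency of
    alpha(y, e_1) /\ ... /\ alpha(y, e_N) along a Morley sequence (e_i) of p. *)
Require Import Defs.
From mathcomp Require Import all_boot all_classical.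
From Stdlib Require List.

Set Implicit Arguments.
Unset Strict Implicit.
Unset Printing Implicit Defensive.

Local Open Scope classical_set_scope.

Local Notation In := List.In.

(** * Small cardinals *)

(** An ultrafilter on tuples is finer than the type it carries: only its trace on definable sets is
    canonical. It is used because [iterQ] can iterate it over arbitrary predicates. For a coheir the
    iterated tuples lie in M, so sections of a definable relation keep their parameters, and Morley
    sequences can be traded for iterated quantifiers. In (i) => (ii) the type is only known to be
    invariant, so that half argues with actual sequences instead. The obstacle in (ii) => (i) is
    that forking allows a disjunction of dividing formulas, each inconsistent along a different
    coheir. They are eliminated one at a time: a formula inconsistent along s terms of its coheir is
    removed by taking s conjugates of all the remaining data, so the number of copies of a_0 is
    multiplied by s. The number N of the broom lemma is the product of these lengths. Condition (ii)
    enters that lemma only through one fact: a realization of p|M still realizes p over every set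
    whose type over it is finitely satisfiable in M. Tuples may be infinite and the cardinal is an
    arbitrary type [K], which explains the cardinal arithmetic and the passage from one-variable
    saturation to small tuples. *)

Lemma card_leTP I J :
  ([set: I] #<= [set: J])%card <-> exists f : I -> J, injective f.
Proof.
split=> [/card_leP[f]|[f f_inj]]; last first.
  have : (range f #= [set: I])%card by apply: inj_card_eq => x y _ _ /f_inj.
  rewrite card_eq_sym => /card_eqPle[le1 _];
    exact: card_le_trans le1 (card_leT _).
exists (fun i => set_val (f (SigSub (mem_set (Logic.I : [set: I] i))))).
by move=> x y /= /val_inj /inj; rewrite !inE =>
  /(_ Logic.I Logic.I) /(congr1 val).
Qed.

(** Zorn's lemma on graphs of partial injections: a maximal graph is total on one of the two
    sides. *)
Lemma card_le_totalT I J :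
  ([set: I] #<= [set: J])%card \/ ([set: J] #<= [set: I])%card.
Proof.
pose P (G : set (I * J)) := forall i j i' j', G (i, j) -> G (i', j') ->
  i = i' <-> j = j'.
have [|G [PG maxG]] := @Zorn_bigcup (I * J)%type P.
  move=> F FP totF i j i' j' [A FA Aij] [A' FA' Aij'].
  case: (totF _ _ FA FA') => sub.
    by apply: (FP _ FA') => //; apply: sub.
  by apply: (FP _ FA) => //; apply: sub.
have [domG|/existsNP[i0 ndomG]] := pselect (forall i, exists j, G (i, j)).
  left; apply/card_leTP.
  exists (fun i => sval (cid (domG i))) => i i'.
  case: cid => j Gj; case: cid => j' Gj' /= eqj; exact/(PG _ _ _ _ Gj Gj').
have [ranG|/existsNP[j0 nranG]] := pselect (forall j, exists i, G (i, j)).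
  right; apply/card_leTP.
  exists (fun j => sval (cid (ranG j))) => j j'.
  case: cid => i Gi; case: cid => i' Gi' /= eqi; exact/(PG _ _ _ _ Gi Gi').
case: (maxG (G `|` [set (i0, j0)])).
  split; first by move=> x Gx; left.
  by move=> /(_ (i0, j0)) /(_ (or_intror erefl)) ?; apply: ndomG; exists j0.
move=> i j i' j' [Gij|[-> ->]] [Gij'|[-> ->]] //.
- exact: PG.
- split=> eq; first by subst i; case: ndomG; exists j.
  by subst j; case: nranG; exists i.
- split=> eq; first by subst i'; case: ndomG; exists j'.
  by subst j'; case: nranG; exists i'.
Qed.

(** Smallness of sums and of countable families of tuples rests on this. Inside each countable
    class, a pairing of [nat * nat] with [nat] does the work. *)
Lemma card_prod_nat J :
  infinite_set [set: J] -> ([set: J * nat] #<= [set: J])%card.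
Proof.
move=> /infiniteP /card_leTP[h h_inj].
(* Partition J, up to finitely many points, into countable classes; the class
   of s is enumerated by n |-> j when G (s, n, j). *)
pose P (G : set (J * nat * J)) :=
  [/\ forall s n j s' n' j', G (s, n, j) -> G (s', n', j') ->
        (s = s' /\ n = n') <-> j = j',
      forall s n j n', G (s, n, j) -> exists j', G (s, n', j') &
      forall s n j, G (s, n, j) -> G (s, 0, s)].
have [|G [[PG totG diagG] maxG]] := @Zorn_bigcup (J * nat * J)%type P.
  move=> F FP totF; split.
  - move=> s n j s' n' j' [A FA Aij] [A' FA' Aij'].
    case: (totF _ _ FA FA') => sub.
      by have [+ _ _] := FP _ FA'; apply => //; apply: sub.
    by have [+ _ _] := FP _ FA; apply => //; apply: sub.
  - move=> s n j n' [A FA Aij]; have [_ /(_ _ _ _ n' Aij)[j' Aj'] _] := FP _ FA.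
    by exists j', A.
  - move=> s n j [A FA Aij]; have [_ _ /(_ _ _ _ Aij) As] := FP _ FA.
    by exists A.
pose lft := [set j | forall s n, ~ G (s, n, j)].
have fin_lft : finite_set lft.
  apply: contrapT => /infiniteP /card_leP[g].
  pose f n := set_val (g (SigSub (mem_set (I : [set: nat] n)))).
  have f_inj : injective f.
    by move=> x y /= /val_inj /inj; rewrite !inE => /(_ I I) => /(congr1 val).
  have f_lft n : lft (f n) by apply: set_mem; apply: valP.
  (* An infinite remainder would contain one more countable class, represented by [f 0]. *)
  case: (maxG (G `|` [set x | exists n, x = (f 0, n, f n)])).
    split; first by move=> x Gx; left.
    move=> /(_ (f 0, 0, f 0)) /(_ (or_intror (ex_intro _ 0 erefl))).
    exact: (f_lft 0).
  split.
  - move=> s n j s' n' j' [Gj|[m [-> -> ->]]] [Gj'|[m' [-> -> ->]]].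
    + exact: PG.
    + split=> [[ss _]|jj]; last by subst j; case: (f_lft m' _ _ Gj).
      by move/diagG: Gj; rewrite ss => /f_lft.
    + split=> [[ss _]|jj]; last by subst j'; case: (f_lft m _ _ Gj').
      by move/diagG: Gj'; rewrite -ss => /f_lft.
    + by split=> [[_ ->]|/f_inj ->].
  - move=> s n j n' [/(totG _ _ _ n')[j' Gj']|[m [-> _ _]]].
      by exists j'; left.
    by exists (f n'); right; exists n'.
  - move=> s n j [/diagG Gs|[m [-> _ _]]]; first by left.
    by right; exists 0.
have [r r_inj] : exists r : J -> nat, {in lft &, injective r}.
  have := finite_set_countable fin_lft.
  by move=> /countable_injP[r rinj]; exists r.
have [s0 Gs0] : exists s0, G (s0, 0, s0).
  apply: contrapT => noG; have: infinite_set lft; last exact.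
  have -> : lft = setT.
    by rewrite -subTset => j _ s n Gj; apply: noG; exists s; apply: diagG Gj.
  by apply/infiniteP/card_leTP; exists h.
(* A point of a class stays in its class and receives an even index; the finitely many leftover
   points are sent to the class of [s0] with odd indices. *)
pose enc (x : J * nat) : J * nat :=
  match pselect (exists sn : J * nat, G (sn.1, sn.2, x.1)) with
  | left e => ((sval (cid e)).1, (pickle ((sval (cid e)).2, x.2)).*2)
  | right _ => (s0, (pickle (r x.1, x.2)).*2.+1)
  end.
have encG x : exists j, G (enc x, j).
  rewrite /enc; case: pselect => [e|_]; last exact: totG Gs0.
  by case: cid => sn /= Gx; apply: totG Gx.
have enc_inj : injective enc.
  move=> [j m] [j' m']; rewrite /enc.
  have dN (a b : nat) : a.*2 <> b.*2.+1.
    by move=> /(congr1 odd); rewrite /= !odd_double.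
  case: pselect => [e|ne]; case: pselect => [e'|ne'] /=.
  - case: cid => -[s n] /= G1; case: cid => -[s' n'] /= G2.
    move=> [ss /double_inj/(pcan_inj pickleK)[nn ->]].
    by congr pair; apply/(PG _ _ _ _ _ _ G1 G2).
  - by move=> [_ /dN].
  - by move=> [_ /esym/dN].
  - move=> [/double_inj/(pcan_inj pickleK)[rr ->]]; congr pair.
    apply: r_inj => //; apply/mem_set => s n Gj.
      by apply: ne; exists (s, n).
    by apply: ne'; exists (s, n).
apply/card_leTP; exists (fun x => sval (cid (encG x))) => x y.
case: cid => j Gj; case: cid => j' Gj' /= jj; apply: enc_inj.
move: Gj Gj'; case: (enc x) => s n; case: (enc y) => s' n' Gj Gj'.
by have [] := (PG _ _ _ _ _ _ Gj Gj').2 jj => -> ->.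
Qed.

Section Small.
Variable K : Type.
Hypothesis nat_small : small K nat.

Lemma small_inj I J (f : I -> J) : injective f -> small K J -> small K I.
Proof.
move=> f_inj [JK nKJ].
have IJ : ([set: I] #<= [set: J])%card by apply/card_leTP; exists f.
split; first exact: card_le_trans IJ JK.
by move=> KI; apply: nKJ; apply: card_le_trans KI IJ.
Qed.

Lemma small_surj I J (f : J -> I) : (forall i, exists j, f j = i) ->
  small K J -> small K I.
Proof.
move=> f_surj; apply: (@small_inj _ _ (fun i => sval (cid (f_surj i)))).
by move=> i i'; case: cid => j e; case: cid => j' e' /= jj; rewrite -e -e' jj.
Qed.

Lemma small_prod_nat I : small K I -> small K (I * nat).
Proof.
move=> I_small; have [finI|/card_prod_nat /card_leTP[f f_inj]] :=
  pselect (finite_set [set: I]); last exact: small_inj f_inj I_small.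
have /finite_set_countable/countable_injP[r r_inj] := finI.
apply: (@small_inj _ _ (fun x : I * nat => pickle (r x.1, x.2))) nat_small.
by move=> [i n] [i' n'] /(pcan_inj (@pickleK _))[rr ->]; congr pair;
  apply: r_inj rr; apply: mem_set.
Qed.

Lemma small_sum I J : small K I -> small K J -> small K (I + J).
Proof.
move=> I_small J_small.
wlog /card_leTP[f f_inj] : I J I_small J_small / ([set: I] #<= [set: J])%card.
  move=> wlg; case: (card_le_totalT I J) => [|JI]; first exact: wlg.
  apply: (@small_inj _ _ (fun x : I + J => match x with inl i =>
    inr i | inr j => inl j end)
    _ (wlg _ _ J_small I_small JI)).
  by move=> [i|j] [i'|j'] // [->].
apply: (@small_inj _ _ (fun x : I + J => match x with inl i => (f i,
  0) | inr j => (j, 1) end)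
    _ (small_prod_nat J_small)).
by move=> [i|j] [i'|j'] // [] // => [/f_inj|] ->.
Qed.

Lemma small_fin n : small K 'I_n.
Proof. exact: small_inj (@ord_inj n) nat_small. Qed.

Variable U : Type.

Definition small_set (A : set U) := small K {u | A u}.

Lemma small_set_sub (A B : set U) : A `<=` B -> small_set B -> small_set A.
Proof.
move=> AB; apply: (@small_inj _ _ (fun u : {u | A u} =>
  exist B (sval u) (AB _ (svalP u)))).
by move=> [u Au] [v Av] /= [uv]; subst v; congr exist; apply: Prop_irrelevance.
Qed.

Lemma small_set_range I (f : I -> U) : small K I -> small_set (range f).
Proof.
apply: (@small_surj _ _ (fun i => exist (range f) (f i) (ex_intro2 _ _ i
  Logic.I erefl))).
by move=> [u ru]; have [i _ fi] := ru; exists i; exact: eq_exist.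
Qed.

Lemma small_set_setU (A B : set U) : small_set A -> small_set B ->
  small_set (A `|` B).
Proof.
move=> As Bs; apply: (@small_surj _ _ (fun x : {u | A u} + {u | B u} =>
  match x with
  | inl u => exist (A `|` B) (sval u) (or_introl (svalP u))
  | inr u => exist (A `|` B) (sval u) (or_intror (svalP u))
  end) _ (small_sum As Bs)).
move=> [u ABu]; have [Au|Bu] := ABu.
  by exists (inl (exist _ u Au)); exact: eq_exist.
by exists (inr (exist _ u Bu)); exact: eq_exist.
Qed.

Lemma small_set_set0 : small_set set0.
Proof. by apply: (@small_inj _ _ (fun=> 0)) nat_small => -[]. Qed.

End Small.

(** * Definable sets *)

Lemma In_mem (T : eqType) (x : T) (s : seq T) : In x s <-> x \in s.
Proof.
elim: s => [|y s IH] //=; rewrite inE; split.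
  by case=> [->|/IH ->]; rewrite ?eqxx ?orbT.
by case/orP=> [/eqP ->|/IH]; [left|right].
Qed.

Section Sat.
Variables (L : language) (N : structure L).

Lemma eval_trename V W (s : V -> W) (e : W -> N) (t : term L V) :
  eval e (trename s t) = eval (e \o s) t.
Proof. by elim: t => //= f ts IH; congr fun_interp; apply: funext => i. Qed.

Lemma sat_rename V W (s : V -> W) (e : W -> N) (phi : formula L V) :
  sat e (rename s phi) <-> sat (e \o s) phi.
Proof.
elim: phi W s e => //= {V}.
- by move=> V t u W s e; rewrite !eval_trename.
- move=> V r ts W s e.
  by under eq_fun do rewrite eval_trename.
- by move=> V phi IH psi IH' W s e; rewrite IH IH'.
- move=> V phi IH W s e; have H x : oapp e x \o omap s = oapp (e \o s) x.
    by apply: funext; case.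
  by split=> sat_phi x; move: (sat_phi x); rewrite IH H.
Qed.

Lemma eval_support V (t : term L V) : exists s : seq V,
  forall e e' : V -> N, (forall v, In v s -> e v = e' v) ->
  eval e t = eval e' t.
Proof.
elim: t => [v|f ts /choice[s sP]].
  by exists [:: v] => e e'; apply; left.
exists (List.flat_map s (enum 'I_(fun_ar f))) => e e' ee' /=.
congr fun_interp; apply: funext => i; apply: sP => v vi; apply: ee'.
by apply/List.in_flat_map; exists i; split=> //; apply/In_mem; rewrite mem_enum.
Qed.

(** Variables are indexed by an arbitrary type, so the finiteness of the set of free variables has
    to be extracted; compactness arguments on infinite tuples depend on it. *)
Lemma sat_support V (phi : formula L V) : exists s : seq V,
  forall e e' : V -> N, (forall v, In v s -> e v = e' v) ->
  (sat e phi <-> sat e' phi).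
Proof.
elim: phi => {V} [V|V t u|V r ts|V phi [s sP] psi [s' sP']|V phi [s sP]] /=.
- by exists [::].
- have [[s sP] [s' sP']] := (eval_support t, eval_support u).
  exists (s ++ s') => e e' ee'; rewrite (sP e e') ?(sP' e e') //.
    by move=> v vs; apply/ee'/List.in_or_app; right.
  by move=> v vs; apply/ee'/List.in_or_app; left.
- have [s sP] := choice (fun i => eval_support (ts i)).
  exists (List.flat_map s (enum 'I_(rel_ar r))) => e e' ee'.
  suff -> : (fun i => eval e (ts i)) = (fun i => eval e' (ts i)) by [].
  apply: funext => i; apply: sP => v vi; apply: ee'.
  apply/List.in_flat_map; exists i; split=> //.
  by apply/In_mem; rewrite mem_enum.
- exists (s ++ s') => e e' ee'; rewrite (sP e e') ?(sP' e e') //.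
    by move=> v vs; apply/ee'/List.in_or_app; right.
  by move=> v vs; apply/ee'/List.in_or_app; left.
(* [pmap id] removes [None], the bound variable, and strips [Some] from the others. *)
- exists (pmap id s) => e e' ee'.
  have H x : sat (oapp e x) phi <-> sat (oapp e' x) phi.
    apply: sP => -[v|] //= vs; apply: ee'.
    elim: s vs => [|[w|] s IH] //=.
      by case=> [[->]|/IH]; [left|right].
    by case=> // /IH.
  by split=> sat_phi x; apply/H.
Qed.

End Sat.

Section Definable.
Variables (L : language) (U : structure L).

(* An A-definable set of tuples; unlike in [over], the parameters are not
   listed, which makes the closure properties immediate. *)
Definition definable V (A : set U) (R : (V -> U) -> Prop) : Prop :=
  exists phi : formula L (V + {u | A u}),
    forall a, R a <-> sat (join a sval) phi.

Lemma definable_ext V A (R R' : (V -> U) -> Prop) :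
  (forall a, R a <-> R' a) -> definable A R -> definable A R'.
Proof. by move=> RR' [phi phiP]; exists phi => a; rewrite -phiP RR'. Qed.

(** Each coordinate of [f a] is a variable or a constant, so a renaming of variables suffices. This
    is the one substitution principle behind the definability checks below. *)
Lemma definable_comp V W (A B : set U) (R : (V -> U) -> Prop)
    (f : (W -> U) -> V -> U) :
  A `<=` B ->
  (forall v, (exists w, forall a, f a v = a w) \/
             (exists2 u, B u & forall a, f a v = u)) ->
  definable A R -> definable B (fun a => R (f a)).
Proof.
move=> AB fP [phi phiP].
have /choice[h hP] v : exists x : W + {u | B u}, forall a,
  f a v = join a sval x.
  case: (fP v) => [[w wP]|[u Bu uP]]; first by exists (inl w).
  by exists (inr (exist _ u Bu)).
pose k (x : V + {u | A u}) := match x with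
  | inl v => h v
  | inr u => inr (exist B (sval u) (AB _ (svalP u)))
  end.
exists (rename k phi) => a; rewrite sat_rename phiP.
suff -> : join (f a) sval = join a sval \o k by [].
by apply: funext => -[v|u] //=.
Qed.

Lemma definable_sub V (A B : set U) (R : (V -> U) -> Prop) :
  A `<=` B -> definable A R -> definable B R.
Proof. by move=> AB; apply: (definable_comp (f := id)) => // v; left;
  exists v. Qed.

Lemma definable_False V A : definable A (fun _ : V -> U => False).
Proof. by exists Bot. Qed.

Lemma definable_imp V A (R S : (V -> U) -> Prop) :
  definable A R -> definable A S -> definable A (fun a => R a -> S a).
Proof.
by move=> [phi phiP] [psi psiP]; exists (Imp phi psi) => a /=;
  rewrite phiP psiP.
Qed.

Lemma definable_not V A (R : (V -> U) -> Prop) : definable A R ->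
  definable A (fun a => ~ R a).
Proof. by move=> RA; exact: (definable_imp RA (definable_False _ _)). Qed.

Lemma definable_or V A (R S : (V -> U) -> Prop) :
  definable A R -> definable A S -> definable A (fun a => R a \/ S a).
Proof.
move=> RA SA; apply: definable_ext (definable_imp (definable_not RA) SA) => a;
  split.
  by move=> H; have [|/H] := pselect (R a); [left|right].
by case.
Qed.

Lemma definable_and V A (R S : (V -> U) -> Prop) :
  definable A R -> definable A S -> definable A (fun a => R a /\ S a).
Proof.
move=> RA SA; apply: definable_ext (definable_not (definable_or (definable_not
  RA) (definable_not SA))).
move=> a; split; last by move=> [Ra Sa] [].
by move/not_orP => [/contrapT ? /contrapT ?].
Qed.

Lemma definable_True V A : definable A (fun _ : V -> U => True).
Proof. by apply: definable_ext (definable_not (definable_False _ _)) => a;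
  split=> // _ []. Qed.

Lemma definable_all1 V A (R : (option V -> U) -> Prop) :
  definable A R -> definable A (fun a : V -> U => forall u, R (oapp a u)).
Proof.
move=> [phi phiP].
pose k (x : option V + {u | A u}) : option (V + {u | A u}) := match x with
  | inl (Some v) => Some (inl v) | inl None => None | inr u => Some (inr u)
  end.
exists (All (rename k phi)) => a /=.
have H u : join (oapp a u) sval = oapp (join a sval) u \o k.
  by apply: funext => -[[v|]|w].
by split=> Ra u; move: (Ra u); rewrite phiP sat_rename H.
Qed.

Lemma definable_ex1 V A (R : (option V -> U) -> Prop) :
  definable A R -> definable A (fun a : V -> U => exists u, R (oapp a u)).
Proof.
move=> RA; apply: definable_ext (definable_not (definable_all1 (definable_not
  RA))) => a.
by split=> [/existsNP[u /contrapT Ru]|[u Ru] /(_ u)]; first by exists u.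
Qed.

Lemma definable_ex V A n (R : (V + 'I_n -> U) -> Prop) :
  definable A R -> definable A (fun a : V -> U => exists w : 'I_n -> U,
    R (join a w)).
Proof.
elim: n V R => [|n IH] V R RA.
  pose w0 (i : 'I_0) : U := False_rect U (notF (valP i)).
  have w0E w : w = w0 by apply: funext => i; case: (notF (valP i)).
  apply: (@definable_ext _ _ (fun a => R (join a w0))).
    by move=> a; split=> [Ra|[w]]; [exists w0|rewrite (w0E w)].
  apply: (definable_comp (f := fun a => join a w0)) RA => // -[v|i].
    by left; exists v.
  by case: (notF (valP i)).
pose g (a : option V + 'I_n -> U) (x : V + 'I_n.+1) : U := match x with
  | inl v => a (inl (Some v))
  | inr i => if unlift ord0 i is Some j then a (inr j) else a (inl None)
  end.
have /IH/definable_ex1 : definable A (fun a => R (g a)).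
  apply: definable_comp RA => // -[v|i]; left; first by exists (inl (Some v)).
  rewrite /g; case: (unlift ord0 i) => [j|]; first by exists (inr j).
  by exists (inl None).
apply: definable_ext => a; split=> [[u [w Ruw]]|[w Rw]].
  exists (fun i => if unlift ord0 i is Some j then w j else u).
  by congr R: Ruw; apply: funext => -[v|i].
exists (w ord0), (fun j => w (lift ord0 j)); congr R: Rw.
apply: funext => -[v|i] //=; case: unliftP => [j|] -> //.
Qed.

Lemma definable_list V A I (l : seq I) (R : I -> (V -> U) -> Prop) :
  (forall i, In i l -> definable A (R i)) ->
  definable A (fun a => forall i, In i l -> R i a).
Proof.
elim: l => [|i l IH] lP; first by apply: definable_ext (definable_True _ _) =>
  a; split.
have Ri : definable A (R i) by apply: lP; left.
have /IH Rl : forall j, In j l -> definable A (R j) by move=> j jl; apply: lP;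
  right.
apply: definable_ext (definable_and Ri Rl) => a; split=> [[Ra la]
  j [<-//|]|la]; first exact: la.
by split=> [|j jl]; apply: la; [left|right].
Qed.

(** Parameters become variables, so that they can later be replaced by another tuple of the same
    type. *)
Lemma definable_param V Y (A B : set U) (c : Y -> U) (R : (V -> U) -> Prop) :
  (forall u, B u -> A u \/ exists y, c y = u) -> definable B R ->
  exists2 R0 : (V + Y -> U) -> Prop, definable A R0 &
    forall a, R a <-> R0 (join a c).
Proof.
move=> BP [phi phiP].
have /choice[k kP] (x : V + {u | B u}) : exists z : V + Y + {u | A u},
    forall a, join a sval x = join (join a c) sval z.
  case: x => [v|[u Bu]]; first by exists (inl (inl v)).
  have [Au|[y cy]] := BP _ Bu; first by exists (inr (exist _ u Au)).
  by exists (inl (inr y)) => a.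
exists (fun b => sat (join b sval) (rename k phi));
  first by exists (rename k phi).
move=> a; rewrite phiP sat_rename.
suff -> : join a sval = join (join a c) sval \o k by [].
by apply: funext => x; rewrite kP.
Qed.

Lemma definable_support V A (R : (V -> U) -> Prop) : definable A R ->
  exists s : seq V, forall a a', (forall v, In v s -> a v = a' v) ->
    (R a <-> R a').
Proof.
move=> [phi phiP]; have [s sP] := sat_support U phi.
exists (pmap (fun x => if x is inl v then Some v else None) s) => a a' aa'.
rewrite !phiP; apply: sP => -[v|//] /= vs; apply: aa'.
elim: s vs => [|[w|w] s IH] //=; first by case=> [[->]|/IH]; [left|right].
by case=> // /IH.
Qed.

Lemma holds_inst X n (phi : formula L (X + 'I_n)) (b : 'I_n -> U) (a : X -> U) :
  holds a (inst phi b) <-> sat (join a b) phi.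
Proof.
rewrite /holds sat_rename; suff -> : join a id \o join inl (inr \o b) = join a
  b by [].
by apply: funext => -[].
Qed.

Lemma over_definable X A (phi : lformula U X) : Defs.over A phi ->
  definable A (fun a => holds a phi).
Proof.
move=> [n [psi [b [bA ->]]]]; pose k := fun i => exist A (b i) (bA i).
exists (rename (fun x => match x with inl v => inl v | inr i =>
  inr (k i) end) psi).
move=> a; rewrite holds_inst sat_rename.
suff -> : join a b = join a sval \o (fun x => match x with inl v =>
  inl v | inr i => inr (k i) end) by [].
by apply: funext => -[].
Qed.

Lemma definable_over X A (R : (X -> U) -> Prop) : definable A R ->
  exists2 phi : lformula U X, Defs.over A phi & forall a, holds a phi <-> R a.
Proof.
move=> [phi phiP].
(* The list of parameters is read with a default entry [u0]; when A is empty no parameter can occur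
   and the empty list is taken. *)
have [[u0 Au0]|noA] := pselect (exists u, A u); last first.
  pose b (i : 'I_0) : U := False_rect U (notF (valP i)).
  pose k (x : X + {u | A u}) : X + 'I_0 := match x with
    | inl v => inl v
    | inr u => match noA (ex_intro _ _ (svalP u)) with end
    end.
  exists (inst (rename k phi) b).
    by exists 0, (rename k phi), b; split=> // i; case: (notF (valP i)).
  move=> a; rewrite phiP holds_inst sat_rename.
  suff -> : join a b \o k = join a sval by [].
  by apply: funext => -[v|u] //=; case: (noA _).
have [s sP] := sat_support U phi.
pose q := u0 :: pmap (fun x => if x is inr u then Some (sval u) else None) s.
have qA (i : 'I_(size q)) : A (nth u0 q i).
  case: i => -[|i] //= _; elim: s i {sP q} => [|[x|[u Au]] s IH] [|i] //=.
pose b (i : 'I_(size q)) := nth u0 q i.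
have /choice[k kP] (x : X + {u | A u}) : exists z : X + 'I_(size q),
    In x s -> forall a, join a sval x = join a b z.
  case: x => [v|u]; first by exists (inl v).
  have [us|] := pselect (In (inr u) s); last by exists (inr ord0).
  suff [i iq ub] : exists2 i, i < size q & nth u0 q i = sval u.
    by exists (inr (Ordinal iq)) => _ a; rewrite /b /= ub.
  suff [i iq ub] : exists2 i, i < (size q).-1 & nth u0 (behead q) i = sval u.
    by exists i.+1.
  rewrite /q /=; elim: s us {sP qA b q} => [|x s IH] //= [->|/IH[i iq iE]].
    by exists 0.
  by case: x => [x|x] /=; [exists i|exists i.+1].
exists (inst (rename k phi) b); first by exists (size q), (rename k phi), b.
move=> a; rewrite phiP holds_inst sat_rename; apply: sP => x xs /=.
by rewrite (kP _ xs).
Qed.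

End Definable.

(** * Ultrafilters and saturation *)

Lemma finite_list T (F : set T) : finite_set F ->
  exists l : seq T, forall x, F x <-> In x l.
Proof.
move=> /(@finite_seqP {classic T})[l ->]; exists l => x.
exact: (iff_sym (@In_mem {classic T} x l)).
Qed.

Section Ultra.
Variable T : Type.

Lemma ultra_base (B : set (set T)) : B !=set0 ->
  (forall A A', B A -> B A' -> exists2 C, B C & C `<=` A `&` A') ->
  (forall A, B A -> exists x, A x) ->
  exists2 D : set (set T), UltraFilter D & B `<=` D.
Proof.
move=> [A0 BA0] BI B0.
have FF : Filter (filter_from B id).
  by apply: filter_from_filter; first by exists A0.
have [|D [uD BD]] := @ultraFilterLemma _ (filter_from B id).
  exact: filter_from_proper.
by exists D => // A BA; apply: BD; exists A.
Qed.

Variables (D : set (set T)) (uD : UltraFilter D).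

Lemma ultraN (A : set T) : D (~` A) <-> ~ D A.
Proof.
split; last by case: (in_ultra_setVsetC A uD).
by move=> nA DA; have [x []] := filter_ex (filterI DA nA).
Qed.

Lemma ultra_list I (l : seq I) (R : I -> set T) :
  (forall i, In i l -> D (R i)) -> D (fun x => forall i, In i l -> R i x).
Proof.
elim: l => [|i l IH] lR; first exact: filterS filterT.
have Ri : D (R i) by apply: lR; left.
have /IH Rl : forall j, In j l -> D (R j) by move=> j jl; apply: lR; right.
by apply: filterS (filterI Ri Rl) => x [Rx lx] j [<-//|/lx].
Qed.

Lemma ultra_exists I (l : seq I) (R : I -> set T) :
  D (fun x => exists2 i, In i l & R i x) -> exists2 i, In i l & D (R i).
Proof.
move=> Dl; apply: contrapT => nl.
have /ultra_list Dn : forall i, In i l -> D (~` R i).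
  by move=> i il; apply/ultraN => Di; apply: nl; exists i.
by have [x [[i il Ri] /(_ _ il)]] := filter_ex (filterI Dl Dn).
Qed.

End Ultra.

Lemma nonprincipal_ultra : exists2 W : set (set nat), UltraFilter W &
  forall A (s : seq nat), W A -> exists2 t, A t & t \notin s.
Proof.
have [||A [n An]|W uW BW] := @ultra_base nat [set A | exists n,
  A = [set m | n <= m]].
- by exists setT, 0; apply/seteqP; split.
- move=> _ _ [n ->] [m ->]; exists [set k | maxn n m <= k];
  first by exists (maxn n m).
  by move=> k /=; rewrite geq_max => /andP[].
- by rewrite An; exists n => /=.
exists W => // A s WA.
have WB : W [set m | (\max_(i <- s) i).+1 <= m] by apply: BW; eexists.
have [t [At st]] := filter_ex (filterI WA WB).
exists t => //; apply/negP => ts; move: st => /=; rewrite ltnNge.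
by rewrite (@leq_bigmax_seq _ s xpredT id t).
Qed.

(** * Renaming as a syntactic operation *)

Section Syntax.
Variables (L : language).

Lemma trename_comp V W Z (s : V -> W) (s' : W -> Z) (t : term L V) :
  trename s' (trename s t) = trename (s' \o s) t.
Proof. by elim: t => //= f ts IH; congr App; apply: funext => i. Qed.

Lemma rename_comp V W Z (s : V -> W) (s' : W -> Z) (phi : formula L V) :
  rename s' (rename s phi) = rename (s' \o s) phi.
Proof.
elim: phi W Z s s' => //= {V}.
- by move=> V t u W Z s s'; rewrite !trename_comp.
- by move=> V r ts W Z s s'; congr Rel; apply: funext => i;
  rewrite trename_comp.
- by move=> V phi IH psi IH' W Z s s'; rewrite IH IH'.
- move=> V phi IH W Z s s'; rewrite IH; congr (All (rename _ _)).
  by apply: funext; case.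
Qed.

Lemma trename_id V (t : term L V) : trename id t = t.
Proof. by elim: t => //= f ts IH; congr App; apply: funext => i. Qed.

Lemma rename_id V (phi : formula L V) : rename id phi = phi.
Proof.
elim: phi => //= {V}.
- by move=> V t u; rewrite !trename_id.
- by move=> V r ts; congr Rel; apply: funext => i; rewrite trename_id.
- by move=> V phi -> psi ->.
- move=> V phi IH; rewrite -[in RHS]IH; congr (All (rename _ _)).
  by apply: funext; case.
Qed.

Lemma trename_support V (t : term L V) : exists s : seq V,
  forall W (e e' : V -> W), (forall v, In v s -> e v = e' v) ->
  trename e t = trename e' t.
Proof.
elim: t => [v|f ts /choice[s sP]].
  by exists [:: v] => W e e' ee' /=; rewrite ee' //; left.
exists (List.flat_map s (enum 'I_(fun_ar f))) => W e e' ee' /=.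
congr App; apply: funext => i; apply: sP => v vi; apply: ee'.
by apply/List.in_flat_map; exists i; split=> //; apply/In_mem; rewrite mem_enum.
Qed.

(** Types are sets of formulas and [over] requires an equality of formulas, so a support for
    satisfaction is not enough: [over_setT] needs one for the renaming itself. *)
Lemma rename_support V (phi : formula L V) : exists s : seq V,
  forall W (e e' : V -> W), (forall v, In v s -> e v = e' v) ->
  rename e phi = rename e' phi.
Proof.
elim: phi => {V} [V|V t u|V r ts|V phi [s sP] psi [s' sP']|V phi [s sP]] /=.
- by exists [::].
- have [[s sP] [s' sP']] := (trename_support t, trename_support u).
  exists (s ++ s') => W e e' ee'; rewrite (sP W e e') ?(sP' W e e') //.
    by move=> v vs; apply/ee'/List.in_or_app; right.
  by move=> v vs; apply/ee'/List.in_or_app; left.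
- have [s sP] := choice (fun i => trename_support (ts i)).
  exists (List.flat_map s (enum 'I_(rel_ar r))) => W e e' ee'.
  congr Rel; apply: funext => i; apply: sP => v vi; apply: ee'.
  apply/List.in_flat_map; exists i; split=> //.
  by apply/In_mem; rewrite mem_enum.
- exists (s ++ s') => W e e' ee'; rewrite (sP W e e') ?(sP' W e e') //.
    by move=> v vs; apply/ee'/List.in_or_app; right.
  by move=> v vs; apply/ee'/List.in_or_app; left.
- exists (pmap id s) => W e e' ee'; congr All; apply: sP => -[v|] //= vs.
  congr Some; apply: ee'; elim: s vs => [|[w|] s IH] //=.
    by case=> [[->]|/IH]; [left|right].
  by case=> // /IH.
Qed.

Lemma over_setT (U : structure L) X (phi : lformula U X) : Defs.over setT phi.
Proof.
have [u0] := carrier_inh U; have [s sP] := rename_support phi.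
pose q := u0 :: pmap (fun x => if x is inr u then Some u else None) s.
pose b (i : 'I_(size q)) := nth u0 q i.
have /choice[k kP] (x : X + U) : exists z : X + 'I_(size q),
    In x s -> join inl (inr \o b) z = x.
  case: x => [v|u]; first by exists (inl v).
  have [us|] := pselect (In (inr u) s); last by exists (inr ord0).
  suff [i iq ub] : exists2 i, i < size q & nth u0 q i = u.
    by exists (inr (Ordinal iq)) => _; rewrite /= /b /= ub.
  suff [i iq ub] : exists2 i, i < (size q).-1 & nth u0 (behead q) i = u.
    by exists i.+1.
  rewrite /q /=; elim: s us {sP b q} => [|x s IH] //= [->|/IH[i iq iE]].
    by exists 0.
  by case: x => [x|x] /=; [exists i|exists i.+1].
exists (size q), (rename k phi), b; split=> //.
rewrite /inst rename_comp -[LHS]rename_id; apply: sP => x xs.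
by rewrite /= kP.
Qed.

End Syntax.

Section Types.
Variables (L : language) (U : structure L).

(** The solution sets of finite parts of the type form a base. The ultrafilter is not unique, but
    its trace on definable sets is. *)
Lemma type_ultra X (p : set (lformula U X)) : is_type setT p ->
  exists2 D : set (set (X -> U)), UltraFilter D &
    forall phi, p phi <-> D (fun a => holds a phi).
Proof.
move=> [_ p_con p_compl].
have [||_ [F [finF [Fp ->]]]|D uD BD] := @ultra_base (X -> U) [set A | exists F,
    finite_set F /\ F `<=` p /\ A = [set a | forall phi, F phi -> holds a phi]].
- exists setT, set0; split; first exact: finite_set0.
  by split=> [phi []|]; apply/seteqP; split=> // a _ phi [].
- move=> _ _ [F [finF [Fp ->]]] [G [finG [Gp ->]]].
  exists [set a | forall phi, (F `|` G) phi -> holds a phi].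
    exists (F `|` G); split; first by rewrite finite_setU.
    by split=> // phi [/Fp|/Gp].
  by move=> a aFG; split=> phi ?; apply: aFG; [left|right].
- exact: p_con.
exists D => //.
have pD phi : p phi -> D (fun a => holds a phi).
  move=> p_phi; apply: BD; exists [set phi]; split; first exact: finite_set1.
  split; first by move=> _ ->.
  by apply/seteqP; split=> [a ? _ ->|a /(_ phi) H]; last exact: H.
move=> phi; split=> [/pD//|D_phi].
have [//|/pD/ultraN] := p_compl phi (over_setT phi).
by case.
Qed.

Lemma ultra_type X (D : set (set (X -> U))) : UltraFilter D ->
  is_type setT [set phi : lformula U X | D (fun a => holds a phi)].
Proof.
move=> uD; split=> [phi _|F /finite_list[l lF] FD|phi _];
  first exact: over_setT.
  have /(ultra_list uD) Dl : forall phi, In phi l -> D (fun a => holds a phi).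
    by move=> phi /lF /FD.
  by have [a aP] := filter_ex Dl; exists a => phi /lF /aP.
by have [] := in_ultra_setVsetC [set a | holds a phi] uD; [left|right].
Qed.

Definition same_type V (A : set U) (a b : V -> U) :=
  forall R, definable A R -> R a <-> R b.

Lemma same_typeW V (A : set U) (a b : V -> U) :
  (forall R, definable A R -> R a -> R b) -> same_type A a b.
Proof.
move=> ab R RA; split=> [|Rb]; first exact: ab.
by apply: contrapT => nRa; apply: (ab _ (definable_not RA)).
Qed.

Lemma same_type_sym V (A : set U) (a b : V -> U) : same_type A a b ->
  same_type A b a.
Proof. move=> ab R RA. exact: iff_sym (ab R RA). Qed.

Lemma tp_eqP V (A : set U) (a b : V -> U) : tp a A = tp b A <-> same_type A a b.
Proof.
split=> [ab|ab].
  apply: same_typeW => R /definable_over[phi phiA phiR] /phiR a_phi.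
  have : tp a A phi by [].
  by rewrite ab => -[_ /phiR].
by apply/seteqP; split=> phi [phiA a_phi]; split=> //;
  apply/(ab _ (over_definable phiA)).
Qed.

(** Only finitely many coordinates can be quantified while [V] may be infinite; those of [l] are
    freed one by one. *)
Lemma definable_exl V A (l : seq V) (R : (V -> U) -> Prop) : definable A R ->
  definable A (fun a => exists2 a', R a' & forall v, ~ In v l -> a' v = a v).
Proof.
move=> RA; elim: l => [|v l IH].
  apply: definable_ext RA => a; split=> [Ra|H]; first by exists a.
  by have [a' Ra' aa'] := H; suff -> : a = a' by []; apply: funext => v;
    rewrite aa'.
pose f (b : option V -> U) w := if pselect (w = v) then b None else b (Some w).
have : definable A (fun b => exists2 a', R a' & forall w, ~ In w l ->
  a' w = f b w).
  apply: (definable_comp (f := f)) IH => // w; left.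
  have [vw|vw] := pselect (w = v); [exists None|exists (Some w)] => b;
    by rewrite /f; case: pselect.
move/definable_ex1; apply: definable_ext => a; split=> [[u H]|H];
  have [a' Ra' aa'] := H.
  exists a' => // w /= /not_orP[vw wl]; rewrite aa' // /f.
  by case: pselect => // wv; case: vw.
exists (a' v), a' => // w wl; rewrite /f; case: pselect => [wv|wv] /=;
  first by rewrite wv.
by apply: aa' => -[vw|//]; apply: wv.
Qed.

End Types.

(** * Realizing types in a small set of variables *)

Section Saturation.
Variables (L : language) (U : structure L) (K : Type).
Hypotheses (nat_small : small K nat) (U_sat : saturated K U).

(** Saturation is given for one variable only. A maximal partial assignment [G] that meets every
    A-definable member of [D] is total, because one-variable saturation over A and the values of [G]
    extends it to a further coordinate. *)
Lemma realize V (A : set U) (D : set (set (V -> U))) : UltraFilter D ->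
  small K V -> small_set K A -> exists c, forall R, definable A R -> D R -> R c.
Proof.
move=> uD V_small A_small; have [u0] := carrier_inh U.
pose ext (G : set (V * U)) (a : V -> U) := forall v u, G (v, u) -> a v = u.
pose P (G : set (V * U)) :=
  (forall v u u', G (v, u) -> G (v, u') -> u = u') /\
  forall R, definable A R -> D R -> exists2 a, R a & ext G a.
have [|G [[funG satG] maxG]] := @Zorn_bigcup (V * U)%type P.
  move=> F FP totF.
  have funF v u u' : (\bigcup_(X in F) X) (v, u) -> (\bigcup_(X in F) X) (v,
    u') -> u = u'.
    move=> [G FG Gu] [G' FG' Gu']; case: (totF _ _ FG FG') => sub.
      by apply: (FP _ FG').1 Gu'; apply: sub.
    by apply: (FP _ FG).1 Gu _; apply: sub.
  split=> // R RA DR; have [[G0 FG0]|F0] := pselect (exists G, F G); last first.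
    have [a Ra] := filter_ex DR; exists a => // v u [G FG].
    by case: F0; exists G.
  have [s sP] := definable_support RA.
  (* By finite support, a single member of the chain already fixes all the values on which [R]
     depends. *)
  have [G FG Gs] : exists2 G, F G & forall v u, In v s ->
      (\bigcup_(X in F) X) (v, u) -> G (v, u).
    elim: s {sP} => [|w s [G FG Gs]]; first by exists G0.
    have [[u [G' FG' Gu]]|nw] := pselect (exists u, (\bigcup_(X in F) X) (w,
      u)).
      case: (totF _ _ FG FG') => sub.
        exists G' => // v u' [<-|vs] Fu'; last exact/sub/Gs.
        by rewrite (funF _ _ _ Fu' (ex_intro2 _ _ G' FG' Gu)).
      exists G => // v u' [<-|vs] Fu'; last exact: Gs.
      by rewrite (funF _ _ _ Fu' (ex_intro2 _ _ G' FG' Gu)); apply: sub.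
    exists G => // v u [<-|vs] Fu; last exact: Gs.
    by case: nw; exists u.
  have [a Ra Ga] := (FP _ FG).2 _ RA DR.
  exists (fun v => match pselect (exists u, (\bigcup_(X in F) X) (v, u)) with
    | left e => sval (cid e) | right _ => a v end).
    apply: (iffLR (sP a _ _)) Ra => v vs; case: pselect => // e.
    by case: cid => u Fu /=; apply: Ga; apply: Gs.
  move=> v u Fu; case: pselect => [e|[]]; last by exists u.
  by case: cid => u' Fu' /=; apply: funF Fu.
have [tot|/existsNP[v0 nv0]] := pselect (forall v, exists u, G (v, u)).
  have /choice[c cP] := tot; exists c => R RA DR.
  have [a Ra Ga] := satG R RA DR.
  by suff -> : c = a by []; apply: funext => v; rewrite (Ga v (c v)).
(* The values still possible at [v0]: the sets [S R] form the one-variable type to be realized. *)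
pose S (R : (V -> U) -> Prop) u := exists a, [/\ R a, ext G a & a v0 = u].
pose A' := A `|` [set u | exists v, G (v, u)].
pose f (b : unit -> U) v := match pselect (exists u, G (v, u)) with
  | left e => sval (cid e) | right _ => b tt end.
have fG b : ext G (f b).
  move=> v u Gu; rewrite /f; case: pselect => [e|[]]; last by exists u.
  by case: cid => u' Gu' /=; apply: funG Gu.
have fN b v : ~ (exists u, G (v, u)) -> f b v = b tt.
  by rewrite /f; case: pselect.
have S_definable R : definable A R -> definable A' (fun b : unit -> U =>
  S R (b tt)).
  move=> RA; have [s sP] := definable_support RA.
  (* The coordinates relevant to [R], neither assigned by [G] nor equal to [v0]: exactly these are
     quantified away in the definition of [S R]. *)
  pose l := [seq v <- s | `[< ~ (exists u, G (v, u)) /\ v <> v0 >]].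
  have lP v : In v l <-> In v s /\ ~ (exists u, G (v, u)) /\ v <> v0.
    rewrite /l; elim: s {sP l} => [|w s IH] /=; first by split=> [|[]].
    case: asboolP => Gw /=; rewrite IH.
      by split=> [[<-|[? ?]]|[[?|?] ?]]; tauto.
    by split=> [[? ?]|[[ww|?] ?]]; try tauto; subst w; tauto.
  have := definable_exl l RA.
  move=> /(@definable_comp _ _ _ unit _ A' _ f) /= H;
    apply: (definable_ext _ (H _ _)); last 2 first.
  - by move=> u Au; left.
  - move=> v; have [Gv|nGv] := pselect (exists u, G (v, u)); last first.
      by left; exists tt => b; apply: fN.
    right; have [u Gu] := Gv; exists u; first by right; exists v.
    by move=> b; apply: fG.
  move=> b; split=> [[a Ra aP]|[a [Ra Ga av0]]].
    exists a; split=> //.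
      move=> v u Gu; rewrite aP ?(fG _ _ u) // => /lP[_ []].
      by case; exists u.
    by rewrite aP ?fN // => /lP[_ [_]].
  pose a' v := if pselect (In v l) then a v else f b v.
  exists a'; last by move=> v vl; rewrite /a'; case: pselect.
  apply: (iffLR (sP a _ _)) Ra => v vs; rewrite /a'; case: pselect => //= vl.
  have [[u Gu]|nGv] := pselect (exists u, G (v, u));
    first by rewrite (Ga _ u) ?(fG _ _ u).
  rewrite fN //; have [->//|vv0] := pselect (v = v0).
  by case: vl; apply/lP.
pose s := [set phi : lformula U unit | Defs.over A' phi /\
  exists R, [/\ definable A R, D R & forall b, holds b phi <-> S R (b tt)]].
have A'_small : small_set K A'.
  apply: small_set_setU => //; apply: small_set_sub (small_set_range (f (fun=>
    u0)) V_small).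
  by move=> u [v Gu]; exists v => //; apply: fG.
have [||u us] := U_sat A'_small (s := s).
- by move=> phi [].
- move=> F /finite_list[l lF] Fs.
  have /choice[r rP] (phi : lformula U unit) : exists R, F phi -> [/\
    definable A R, D R & forall b, holds b phi <-> S R (b tt)].
    by have [/Fs[_ [R RP]]|] := pselect (F phi); [exists R|exists setT].
  have RA : definable A (fun a => forall phi, In phi l -> r phi a).
    by apply: definable_list => phi /lF /rP[].
  have DR : D (fun a => forall phi, In phi l -> r phi a).
    by apply: ultra_list => phi /lF /rP[].
  have [a Ra Ga] := satG _ RA DR.
  exists (fun=> a v0) => phi Fphi; have [_ _ ->] := rP _ Fphi.
  by exists a; split=> //; apply/Ra/lF.
case: (maxG (G `|` [set (v0, u tt)])).
  split; first by move=> x Gx; left.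
  by move=> /(_ (v0, u tt)) /(_ (or_intror erefl)) ?; apply: nv0; exists (u tt).
split.
  move=> v w w' [Gw|[vv ->]] [Gw'|[vv' ->]] //.
  - exact: funG Gw Gw'.
  - by case: nv0; exists w; rewrite -vv'.
  - by case: nv0; exists w'; rewrite -vv.
move=> R RA DR; have [phi phiA' phiS] := definable_over (S_definable _ RA).
have /us/phiS[a [Ra Ga av0]] : s phi by split=> //; exists R.
by exists a => // v w [/Ga//|[-> ->]].
Qed.

End Saturation.

(** * The Tarski-Vaught test for tuples *)

Section TarskiVaught.
Variables (L : language) (U : structure L) (M : set U).
Hypothesis M_elem : elementary_substructure M.

Lemma elem_pt : exists u, M u.
Proof. by have [[[u Mu]] _] := M_elem; exists u. Qed.

Lemma tarski_vaught1 (R : (unit -> U) -> Prop) a : definable M R -> R a ->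
  exists2 u, M u & R (fun=> u).
Proof.
move=> /definable_over[_ [n [psi [b [bM ->]]]] psiR] /psiR/holds_inst psi_a.
have [Minh [Mcl elem]] := M_elem.
pose e (i : 'I_n) : induced Minh Mcl := exist M (b i) (bM i).
pose k (x : unit + 'I_n) : option 'I_n := if x is inr i then Some i else None.
pose k' (x : unit + 'I_n) : 'I_n.+1 := if x is inr i then lift ord0 i else ord0.
have /elem : sat ((fun i => sval (e i)) : 'I_n ->
  U) (Neg (All (Neg (rename k psi)))).
  move=> /= /(_ (a tt)); apply; apply/sat_rename; congr sat: psi_a.
  by apply: funext => -[[]|i].
move=> /= /existsNP[x /contrapT/sat_rename psi_x].
exists (sval x); first exact: svalP.
pose e' (i : 'I_n.+1) : induced Minh Mcl :=
  if unlift ord0 i is Some j then e j else x.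
have : sat e' (rename k' psi).
  apply/sat_rename; congr sat: psi_x; apply: funext => -[[]|i] /=.
    by rewrite /e' unlift_none.
  by rewrite /e' liftK.
move=> /elem/sat_rename psi_x'; apply/psiR/holds_inst; congr sat: psi_x'.
apply: funext => -[[]|i] /=; first by rewrite /e' unlift_none.
by rewrite /e' liftK.
Qed.

(** Induction on the support: one coordinate at a time is moved into M, and the irrelevant
    coordinates receive any element of M. *)
Lemma tarski_vaught V (R : (V -> U) -> Prop) a : definable M R -> R a ->
  exists2 a', forall v, M (a' v) & R a'.
Proof.
move=> RM; have [s] := definable_support RM.
elim: s R RM a => [|v s IH] R RM a sP Ra.
  by have [u Mu] := elem_pt; exists (fun=> u) => //;
    apply: (iffLR (sP a _ _)) Ra.
pose f (b : option V -> U) w := if pselect (w = v) then b None else b (Some w).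
have fRM : definable M (fun a => exists u, R (f (oapp a u))).
  apply: (definable_ex1 (R := fun b => R (f b))).
  apply: (definable_comp (f := f)) RM => // w; left.
  have [vw|vw] := pselect (w = v); [exists None|exists (Some w)] => b;
    by rewrite /f; case: pselect.
have [||a' a'M [u Ru]] := IH _ fRM a.
- have H b b' : (forall w, In w s -> b w = b' w) ->
    (exists u, R (f (oapp b u))) -> exists u, R (f (oapp b' u)).
    move=> bb' [u Ru]; exists u; apply: (iffLR (sP _ _ _)) Ru => w /= [vw|ws].
      by rewrite /f; case: pselect => // wv; case: wv.
    by rewrite /f; case: pselect => //= _; rewrite bb'.
  by move=> b b' bb'; split; apply: H => // w ws; rewrite bb'.
- exists (a v); congr R: Ra; apply: funext => w; rewrite /f.
  by case: pselect => // wv /=; rewrite wv.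
have fuM : definable M (fun b : unit -> U => R (f (oapp a' (b tt)))).
  apply: (definable_comp (f := fun b => f (oapp a' (b tt)))) RM => // w.
  have [vw|vw] := pselect (w = v).
    by left; exists tt => b; rewrite /f; case: pselect.
  by right; exists (a' w) => // b; rewrite /f; case: pselect.
have [u' Mu' Ru'] := tarski_vaught1 (a := fun=> u) fuM Ru.
exists (f (oapp a' u')) => // w; rewrite /f.
by case: pselect => [_|_] /=.
Qed.

End TarskiVaught.

(** * Forking, coheirs and Morley sequences *)

Notation concentrated M D := (D [set a | forall v, M (a v)]).

Section Forking.
Variables (L : language) (U : structure L).

Lemma definable_formula V A (phi : formula L V) : definable A (fun a : V ->
  U => sat a phi).
Proof. by exists (rename inl phi) => a; rewrite sat_rename. Qed.

Definition realizes_ultra V (D : set (set (V -> U))) (A : set U) (c : V -> U) :=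
  forall R, definable A R -> D R -> R c.

Lemma realizes_ultra_sub V (D : set (set (V -> U))) A B c : A `<=` B ->
  realizes_ultra D B c -> realizes_ultra D A c.
Proof. by move=> AB cB R RA; apply: cB; apply: definable_sub RA. Qed.

Lemma realizes_ultra_iff V (D : set (set (V -> U))) A c R : UltraFilter D ->
  realizes_ultra D A c ->
  definable A R -> R c <-> D R.
Proof.
move=> uD cD RA; split; last exact: cD.
move=> Rc; apply: contrapT => /(ultraN uD) /(cD _ (definable_not RA)); exact.
Qed.

Lemma ultra_realizes V (D : set (set (V -> U))) A c : UltraFilter D ->
  (forall R, definable A R -> R c -> D R) -> realizes_ultra D A c.
Proof.
by move=> uD cD R RA DR; apply: contrapT =>
  /(cD _ (definable_not RA)) /(ultraN uD).
Qed.

Variable M : set U.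

Definition ultra_invariant X (D : set (set (X -> U))) :=
  forall n (phi : formula L (X + 'I_n)) (b b' : 'I_n -> U), same_type M b b' ->
  D [set a | sat (join a b) phi] -> D [set a | sat (join a b') phi].

(** For a tuple [a] of M, the formula [phi(a, y)] is over M and cannot separate [b] from [b']. *)
Lemma concentrated_inv X (D : set (set (X -> U))) : UltraFilter D ->
  concentrated M D -> ultra_invariant D.
Proof.
move=> uD cD n phi b b' bb' Db; apply: filterS (filterI Db cD) => a [/= ab aM].
have H : definable M (fun b : 'I_n -> U => sat (join a b) phi).
  apply: (definable_comp (f := join a)) (definable_formula M phi) => // -[x|i].
    by right; exists (a x).
  by left; exists i.
exact: (iffLR (bb' _ H)).
Qed.

(** Invariance puts all conjugates of the formula into [D], and any k members of [D] have a common
    point. *)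
Lemma inv_nodivides X (D : set (set (X -> U))) psi : UltraFilter D ->
  ultra_invariant D ->
  divides M psi -> ~ D [set a | holds a psi].
Proof.
move=> uD iD [n [phi [b [-> [k [c [cb kinc]]]]]]] Db.
have Db' : D [set a | sat (join a b) phi] by apply: filterS Db => a /holds_inst.
apply: (kinc (fun j => val j) val_inj).
have /(ultra_list uD)/filter_ex[a aP] : forall j, In j (enum 'I_k) ->
    D [set a | holds a (inst phi (c j))].
  move=> j _; have bc := same_type_sym ((tp_eqP _ _ _).1 (cb j)).
  by apply: filterS (iD _ phi _ _ bc Db') => a ?; apply/holds_inst.
by exists a => j; apply: aP; apply/In_mem; rewrite mem_enum.
Qed.

Lemma inv_noforks X (D : set (set (X -> U))) psi : UltraFilter D ->
  ultra_invariant D ->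
  forks M psi -> ~ D [set a | holds a psi].
Proof.
move=> uD iD [F [/finite_list[l lF] Fdiv psiF]] Dpsi.
have /(ultra_exists uD)[phi /lF/Fdiv] :
    D [set a | exists2 phi, In phi l & holds a phi].
  by apply: filterS Dpsi => a /psiF[phi /lF ?]; exists phi.
exact: inv_nodivides.
Qed.

(** The hypothesis lets the negations of all dividing formulas be added to the base; an ultrafilter
    containing them excludes every finite disjunction of dividing formulas. *)
Lemma nonforking_ultra X (B : set (set (X -> U))) : B !=set0 ->
  (forall A A', B A -> B A' -> exists2 C, B C & C `<=` A `&` A') ->
  (forall A F, B A -> finite_set F -> F `<=` divides M ->
    exists2 a, A a & forall phi, F phi -> ~ holds a phi) ->
  exists2 D : set (set (X -> U)), UltraFilter D /\ B `<=` D &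
    forall psi, forks M psi -> ~ D [set a | holds a psi].
Proof.
move=> [T BT] BI BF.
have [|||D uD BD] := @ultra_base _ [set A | exists A0 F, [/\ B A0, finite_set F,
    F `<=` divides M & A = A0 `&` [set a | forall phi, F phi ->
      ~ holds a phi]]].
- by exists (T `&` [set a | forall phi, set0 phi -> ~ holds a phi]); exists T,
  set0; split.
- move=> _ _ [A [F [BA finF Fd ->]]] [A' [F' [BA' finF' Fd' ->]]].
  have [A0 BA0 A0P] := BI _ _ BA BA'.
  exists (A0 `&` [set a | forall phi, (F `|` F') phi -> ~ holds a phi]).
    exists A0, (F `|` F'); split=> //; first by rewrite finite_setU.
    by move=> phi [/Fd|/Fd'].
  move=> a [/A0P[Aa A'a] aFF']; split; split=> // phi Fphi; apply: aFF'.
    by left.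
  by right.
- move=> _ [A [F [BA finF Fd ->]]]; have [a Aa aF] := BF _ _ BA finF Fd.
  by exists a.
exists D.
  split=> // A BA; apply: BD; exists A, set0; split=> //.
  by apply/seteqP; split=> [a Aa|a []//]; split.
move=> psi [F [finF Fd psiF]] Dpsi.
have DF : D [set a | forall phi, F phi -> ~ holds a phi].
  by apply: filterS (BD _ (ex_intro _ T (ex_intro _ F (And4 BT finF Fd
    erefl)))) => a [].
by have [a [/psiF[phi Fphi phia] /(_ _ Fphi)]] := filter_ex (filterI Dpsi DF).
Qed.

Lemma nonforking_tp_ultra X (a : X -> U) A : ~ type_forks M (tp a A) ->
  exists2 D : set (set (X -> U)), UltraFilter D /\ realizes_ultra D A a &
    forall psi, forks M psi -> ~ D [set a | holds a psi].
Proof.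
move=> nf; have [|||D [uD BD] Dnf] :=
  @nonforking_ultra X [set R | definable A R /\ R a].
- by exists setT; split=> //; apply: definable_True.
- move=> R R' [RA Ra] [RA' Ra']; exists (R `&` R') => //.
  by split=> //; apply: definable_and.
- move=> R F [RA Ra] finF Fd; apply: contrapT => nF; apply: nf.
  have [psi psiA psiR] := definable_over RA; exists psi; first by split=> //;
    apply/psiR.
  exists F; split=> // b /psiR Rb; apply: contrapT => nb; apply: nF.
  by exists b => // phi Fphi phib; apply: nb; exists phi.
exists D => //; split=> //; apply: ultra_realizes => // R RA Ra.
exact: BD.
Qed.

End Forking.

(** * Finite satisfiability in M *)

Section Coheir.
Variables (L : language) (U : structure L) (M : set U).
Hypothesis M_elem : elementary_substructure M.

(* tp(C/MB) is finitely satisfiable in M. *)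
Definition finsat (C B : set U) := forall V (c : V -> U),
  (forall v, (M `|` C) (c v)) -> forall R, definable (M `|` B) R -> R c ->
  exists2 m, forall v, M (m v) & R m.

Lemma finsat_sub C C' B B' : C' `<=` C -> B' `<=` B -> finsat C B ->
  finsat C' B'.
Proof.
move=> C'C B'B CB V c cC R RB; apply: CB.
  by move=> v; case: (cC v); [left|right; apply: C'C].
by apply: definable_sub RB => u [?|/B'B ?]; [left|right].
Qed.

Lemma finsat_set0 B : finsat set0 B.
Proof.
move=> V c cM R RB Rc; exists c => // v.
by case: (cM v) => // -[].
Qed.

(** Move the coordinates from C into M first, with A and B as parameters; then those from A, whose
    parameters are by now in M and B. *)
Lemma finsat_trans C A B : finsat C (A `|` B) -> finsat A B ->
  finsat (C `|` A) B.
Proof.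
move=> CAB AB V c cCA R RB Rc; have [m0 Mm0] := elem_pt M_elem.
(* [S] separates the coordinates treated in the first round from those treated in the second; [m0]
   only fills the positions that the current round ignores. *)
pose S v := (M `|` C) (c v).
pose f (x : V -> U) v := if pselect (S v) then x v else c v.
have fc : f c = c by apply: funext => v; rewrite /f; case: pselect.
have [|||m mM Rm] := CAB V (fun v => if pselect (S v) then c v else m0) _ (fun
  x => R (f x)).
- by move=> v; case: pselect => //= _; left.
- apply: (definable_comp (f := f)) RB => [u [?|?]|v]; [by left|by right;
  right|].
  have [Sv|nSv] := pselect (S v).
    by left; exists v => x; rewrite /f; case: pselect.
  right; exists (c v) => [|x]; last by rewrite /f; case: pselect.
  by case: (cCA v) => [?|[?|?]]; [case: nSv; left|case: nSv; right|right; left].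
- congr R: Rc; apply: funext => w; rewrite /f.
  by case: pselect => //= Sw; case: pselect.
pose g (z : V -> U) v := if pselect (S v) then m v else z v.
have [|||m' m'M Rm'] := AB V (fun v => if pselect (S v) then m0 else c v) _
  (fun z => R (g z)).
- move=> v; case: pselect => [_|nSv] /=; first by left.
  by case: (cCA v) => [?|[?|?]]; [left|case: nSv; right|right].
- apply: (definable_comp (f := g)) RB => // v.
  have [Sv|nSv] := pselect (S v).
    by right; exists (m v); [left|move=> x; rewrite /g; case: pselect].
  by left; exists v => x; rewrite /g; case: pselect.
- congr R: Rm; apply: funext => w; rewrite /f /g.
  by case: pselect => //= nSw; case: pselect.
by exists (g m') => // v; rewrite /g; case: pselect => _ /=.
Qed.

Lemma finsat_realizes_ultra V (D : set (set (V -> U))) B c : UltraFilter D ->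
  concentrated M D ->
  realizes_ultra D (M `|` B) c -> finsat (range c) B.
Proof.
move=> uD cD cDB W b bc R RB Rb.
have /choice[h hP] w : exists x : V + {u | M u}, b w = join c sval x.
  case: (bc w) => [Mb|[v _ vb]]; first by exists (inr (exist M _ Mb)).
  by exists (inl v).
pose f (x : V -> U) w := join x sval (h w).
have fRB : definable (M `|` B) (fun x => R (f x)).
  apply: (definable_comp (f := f)) RB => // w; rewrite /f.
  case: (h w) => [v|[u Mu]]; first by left; exists v.
  by right; exists u; first by left.
have /(realizes_ultra_iff uD cDB fRB) Df : R (f c) by congr R: Rb;
  apply: funext.
have [x [Rx Mx]] := filter_ex (filterI Df cD).
by exists (f x) => // w; rewrite /f; case: (h w) => //= -[].
Qed.

Lemma finsat_ultra C B V (c : V -> U) : finsat C B -> (forall v,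
  (M `|` C) (c v)) ->
  exists2 D : set (set (V -> U)), UltraFilter D & concentrated M D /\
    realizes_ultra D (M `|` B) c.
Proof.
move=> CB cC.
have [|||D uD BD] := @ultra_base _ [set A | exists R,
    [/\ definable (M `|` B) R, R c & A = R `&` [set a | forall v, M (a v)]]].
- by eexists; exists setT; split=> //; apply: definable_True.
- move=> _ _ [R [RA Rc ->]] [R' [RA' Rc' ->]];
  exists ((R `&` R') `&` [set a | forall v, M (a v)]).
    by exists (R `&` R'); split=> //; apply: definable_and.
  by move=> a [[]].
- by move=> _ [R [RA Rc ->]]; have [m] := CB _ _ cC _ RA Rc; exists m.
have DR R : definable (M `|` B) R -> R c -> D R.
  move=> RA Rc; have : D (R `&` [set a | forall v, M (a v)]) by apply: BD;
    exists R.
  by apply: filterS => a [].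
exists D => //; split; last exact: ultra_realizes.
by apply: BD; exists setT; split=> //; [apply: definable_True|rewrite setTI].
Qed.

End Coheir.

(** * Morley sequences and iterated ultrafilters *)

Section MorleyLists.
Variables (L : language) (U : structure L) (V : Type).
Implicit Types (Q : set (set (V -> U))) (A : set U) (l : seq (V -> U)).

Definition ranl l : set U := [set u | exists2 c, In c l & range c u].

(* A finite Morley sequence, listed with the last element first. *)
Fixpoint morley Q A l : Prop :=
  if l is c :: l' then realizes_ultra Q (A `|` ranl l') c /\
    morley Q A l' else True.

(** The outermost quantifier binds the head, which is the last term of a Morley list. *)
Fixpoint iterQ Q n (R : seq (V -> U) -> Prop) : Prop :=
  if n is n'.+1 then Q (fun x => iterQ Q n' (fun l => R (x :: l))) else R [::].

(** Coordinates are indexed by [nat * V] whatever the length, so that inductions on [n] do not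
    change the type of the variables. *)
Definition ldefinable A n (R : seq (V -> U) -> Prop) :=
  definable A (fun a : nat * V -> U => R (mkseq (fun i v => a (i, v)) n)).

Lemma mkseq_cons T (f : nat -> T) n : mkseq f n.+1 = f 0 :: mkseq (fun i =>
  f i.+1) n.
Proof. by rewrite /mkseq /= -[1]/(1 + 0) iotaDl -map_comp. Qed.

Lemma ldefinable_cons A B n R x : A `<=` B -> range x `<=` B ->
  ldefinable A n.+1 R -> ldefinable B n (fun l => R (x :: l)).
Proof.
move=> AB xB.
pose f (a : nat * V -> U) (iv : nat * V) :=
  if iv.1 is i.+1 then a (i, iv.2) else x iv.2.
move=> /(@definable_comp _ _ _ _ _ B _ f AB) H.
apply: definable_ext (H _) => [a|[[|i] v]]; first by rewrite mkseq_cons.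
  by right; exists (x v) => //; apply: xB; exists v.
by left; exists (i, v).
Qed.

Lemma ldefinable_head A B n R l : A `<=` B -> ranl l `<=` B -> size l = n ->
  ldefinable A n.+1 R -> definable B (fun x => R (x :: l)).
Proof.
move=> AB lB nl; have [u0] := carrier_inh U.
pose f (x : V -> U) (iv : nat * V) :=
  if iv.1 is i.+1 then nth x l i iv.2 else x iv.2.
move=> /(@definable_comp _ _ _ _ _ B _ f AB) H.
apply: definable_ext (H _) => [x|[i v]].
  rewrite mkseq_cons; suff -> : mkseq (fun i v => f x (i.+1, v)) n = l by [].
  by rewrite -nl -[RHS](mkseq_nth x).
rewrite /f; case: i => [|i] /=; first by left; exists v.
have [il|il] := ltnP i (size l); last first.
  by left; exists v => x; rewrite nth_default.
right; exists (nth (fun=> u0) l i v).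
  apply: lB; exists (nth (fun=> u0) l i); last by exists v.
  elim: l i il {nl f H} => [|c l IH] [|i] //= il; first by left.
  by right; apply: IH.
by move=> x; rewrite (set_nth_default x).
Qed.

Lemma iterQ_mono Q n (R S : seq (V -> U) -> Prop) : UltraFilter Q ->
  (forall l, R l -> S l) -> iterQ Q n R -> iterQ Q n S.
Proof.
move=> uQ; elim: n R S => [|n IH] R S RS /=; first exact: RS.
by apply: filterS => x; apply: IH => l; apply: RS.
Qed.

Lemma iterQ_conc M Q n (R S : seq (V -> U) -> Prop) : UltraFilter Q ->
  concentrated M Q ->
  (forall l, ranl l `<=` M -> size l = n -> R l -> S l) -> iterQ Q n R ->
    iterQ Q n S.
Proof.
move=> uQ cQ; elim: n R S => [|n IH] R S RS /=.
  by apply: RS => // u [].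
move=> QR; apply: filterS (filterI QR cQ) => x [/= xR xM].
apply: IH xR => l lM nl; apply: RS; last by rewrite /= nl.
by move=> u [c [<-|cl] uc]; [case: uc => v _ <-|apply: lM; exists c].
Qed.

Lemma iterQ_False Q n : UltraFilter Q -> ~ iterQ Q n (fun=> False).
Proof. by move=> uQ; elim: n => [|n IH] //= /filter_ex[]. Qed.

Lemma iterQ_and Q n (R S : seq (V -> U) -> Prop) : UltraFilter Q ->
  iterQ Q n R -> iterQ Q n S -> iterQ Q n (fun l => R l /\ S l).
Proof.
move=> uQ; elim: n R S => [|n IH] R S //= QR QS.
by apply: filterS (filterI QR QS) => x [] /IH; apply.
Qed.

Lemma iterQ_list Q n I (s : seq I) (R : I -> seq (V -> U) ->
  Prop) : UltraFilter Q ->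
  (forall i, In i s -> iterQ Q n (R i)) ->
  iterQ Q n (fun l => forall i, In i s -> R i l).
Proof.
move=> uQ; elim: n R => [|n IH] R //= QR.
by apply: filterS (ultra_list uQ QR) => x /IH.
Qed.

Lemma iterQ_cat Q m n (R : seq (V -> U) -> Prop) : UltraFilter Q ->
  iterQ Q m (fun l => iterQ Q n (fun l' => R (l ++ l'))) <-> iterQ Q (m + n) R.
Proof.
move=> uQ; elim: m R => [|m IH] R //=.
by split; apply: filterS => x; apply IH || apply (IH (fun l => R (x :: l))).
Qed.

Lemma morley_iterQ M Q A l R : UltraFilter Q -> concentrated M Q -> M `<=` A ->
  morley Q A l -> ldefinable A (size l) R -> (R l <-> iterQ Q (size l) R).
Proof.
move=> uQ cQ MA; elim: l R => [|c l IH] R //= [cQl lQ] RA.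
have RAl : definable (A `|` ranl l) (fun x => R (x :: l)).
  by apply: ldefinable_head RA.
rewrite (realizes_ultra_iff uQ cQl RAl).
have xP (x : V -> U) : (forall v, M (x v)) ->
    R (x :: l) <-> iterQ Q (size l) (fun l => R (x :: l)).
  move=> xM; apply: (IH (fun l => R (x :: l))) => //;
    apply: ldefinable_cons RA => //.
  by move=> _ [v _ <-]; apply: MA.
by split=> QR; apply: filterS (filterI QR cQ) => x [/= + /xP xE]; rewrite xE.
Qed.

End MorleyLists.

(** * Kim's lemma for coheirs *)

Lemma ultraI T (F : set (set T)) : ProperFilter F ->
  (forall A, F A \/ F (~` A)) -> UltraFilter F.
Proof.
move=> FF FC; split=> // G GG FG; apply/seteqP; split=> // A GA.
by case: (FC A) => // /FG nGA; have [x []] := filter_ex (filterI GA nGA).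
Qed.

Section Consistency.
Variables (L : language) (U : structure L).

Lemma definable_jointly_sat W V n J A (l : seq J) (h : J -> V ->
  W) (R : ('I_n + V -> U) -> Prop) :
  definable A R ->
  definable A (fun a : W -> U => exists y, forall j, In j l ->
    R (join y (fun v => a (h j v)))).
Proof.
move=> RA.
apply: (definable_ex (R := fun b => forall j, In j l ->
  R (join (fun i => b (inr i)) (fun v => b (inl (h j v)))))).
apply: definable_list => j _.
apply: (definable_comp (f := fun b => join (fun i => b (inr i)) (fun v =>
  b (inl (h j v))))) RA => //.
by move=> -[i|v]; left; eexists.
Qed.

Definition jointly_sat n V (R : ('I_n + V -> U) -> Prop) (l : seq (V -> U)) :=
  exists y, forall e, In e l -> R (join y e).

Lemma In_mkseq T (f : nat -> T) n x :
  In x (mkseq f n) <-> exists2 i, i < n & x = f i.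
Proof.
elim: n f => [|n IH] f; first by split=> [|[]].
rewrite mkseq_cons -[In _ _]/(f 0 = x \/ In x (mkseq (fun i => f i.+1) n)) IH.
split=> [[<-|[i ni ->]]|[[|i] ni ->]]; first by exists 0.
- by exists i.+1.
- by left.
- by right; exists i.
Qed.

Lemma jointly_sat_mkseq n V (R : ('I_n + V -> U) -> Prop) (f : nat -> V ->
  U) s :
  jointly_sat R (mkseq f s) <-> exists y, forall i, In i (iota 0 s) ->
    R (join y (f i)).
Proof.
split=> -[y yP]; exists y.
  move=> i /In_mem; rewrite mem_iota add0n => /= si; apply: yP.
  by apply/In_mkseq; exists i.
move=> e /In_mkseq[i si ->]; apply: yP; apply/In_mem.
by rewrite mem_iota.
Qed.

Lemma ldefinable_jointly_sat n V A (R : ('I_n + V -> U) ->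
  Prop) s : definable A R -> ldefinable A s (jointly_sat R).
Proof.
move=> RA; apply: definable_ext (definable_jointly_sat (iota 0 s) (fun i v =>
  (i, v)) RA) => a.
by rewrite jointly_sat_mkseq.
Qed.

End Consistency.

Section Kim.
Variables (L : language) (T : theory L) (K : Type) (U : structure L).
Hypotheses (T_NTP2 : NTP2 T) (U_T : models U T).
Hypotheses (nat_small : small K nat) (U_sat : saturated K U).

Lemma small_set_ranl V (l : seq (V -> U)) : small K V -> small_set K (ranl l).
Proof.
move=> V_small; elim: l => [|c l IH].
  by apply: small_set_sub (small_set_set0 nat_small _) => u [].
apply: small_set_sub (small_set_setU nat_small (small_set_range c V_small) IH)
  => u [d [<-|dl] du].
  by left.
by right; exists d.
Qed.

Lemma morley_exists V (Q : set (set (V -> U))) A n : UltraFilter Q ->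
  small K V -> small_set K A -> exists2 l, size l = n & morley Q A l.
Proof.
move=> uQ V_small A_small; elim: n => [|n [l ln lQ]]; first by exists [::].
have [c cP] := realize nat_small U_sat uQ V_small (small_set_setU nat_small
  A_small (small_set_ranl l V_small)).
by exists (c :: l); rewrite /= ?ln.
Qed.

Section Array.
Variables (n m k : nat) (phi : formula L ('I_n + 'I_m)).

Definition row_inconsistent T0 (e : nat -> 'I_m -> U) := forall i : 'I_k -> nat,
  injective i -> (forall j, i j < T0) ->
  ~ exists y, forall j, In j (enum 'I_k) -> sat (join y (e (i j))) phi.

(** Compactness: the finite arrays, of all sizes at once, generate an ultrafilter on infinite
    arrays, whose type over the empty set is realized by saturation. *)
Lemma array_TP2 : (forall s T0, exists r : nat -> nat -> 'I_m -> U,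
    (forall i, i < s -> row_inconsistent T0 (r i)) /\
    forall f : nat -> nat, (forall i, f i < T0) ->
      jointly_sat (fun a => sat a phi) (mkseq (fun i => r i (f i)) s)) ->
        has_TP2 U phi.
Proof.
move=> arr.
pose good s T0 (a : nat * nat * 'I_m -> U) :=
  let r i t j := a (i, t, j) in
  (forall i, i < s -> row_inconsistent T0 (r i)) /\
    forall f : nat -> nat, (forall i, f i < T0) ->
      jointly_sat (fun a => sat a phi) (mkseq (fun i => r i (f i)) s).
have good_le s T0 s' T0' a : s <= s' -> T0 <= T0' -> good s' T0' a ->
  good s T0 a.
  move=> ss' TT' [rows paths]; split=> [i si j j_inj jT|f fT].
    by apply: (rows i (leq_trans si ss')) => // x; apply: leq_trans TT'.
  have [y yP] := paths f (fun i => leq_trans (fT i) TT').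
  exists y => e /In_mkseq[i si ->]; apply: yP; apply/In_mkseq; exists i => //.
  exact: leq_trans ss'.
have [|||D uD BD] := @ultra_base _ [set A | exists s T0, A = good s T0].
- by exists (good 0 0), 0, 0.
- move=> _ _ [s [T0 ->]] [s' [T0' ->]]; exists (good (maxn s s') (maxn T0 T0')).
    by exists (maxn s s'), (maxn T0 T0').
  by move=> a ga; split; apply: good_le ga; rewrite ?leq_maxl ?leq_maxr.
- move=> _ [s [T0 ->]]; have [r rP] := arr s T0.
  by exists (fun x => r x.1.1 x.1.2 x.2).
have [a aP] : exists a, realizes_ultra D set0 a.
  apply: (realize nat_small U_sat uD _ (small_set_set0 nat_small U)).
  apply: (small_inj (f := pickle)) nat_small.
  exact: pcan_inj (@pickleK _).
exists k, (fun i t j => a (i, t, j)); split=> [i h h_inj [y yP]|f F finF FP].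
  pose R (a : nat * nat * 'I_m -> U) := ~ exists y, forall j,
    In j (enum 'I_k) ->
    sat (join y (fun v => a (i, h j, v))) phi.
  have RA : definable set0 R.
    apply: definable_not.
    exact: (definable_jointly_sat (enum 'I_k) (fun j v => (i, h j,
      v)) (definable_formula set0 phi)).
  suff : D R.
    by move=> /(aP _ RA); apply; exists y => j _; apply/holds_inst/yP.
  have : D (good i.+1 (\max_j h j).+1) by apply: BD; exists i.+1,
    (\max_j h j).+1.
  apply: filterS => b [/(_ i (leqnn _)) + _]; apply=> // j.
  by rewrite ltnS leq_bigmax.
have [l lF] := finite_list finF.
have /choice[g gP] (psi : lformula U 'I_n) : exists i, F psi ->
    psi = inst phi (fun j => a (i, f i, j)).
  by have [/FP[i _ <-]|] := pselect (F psi); [exists i|exists 0].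
pose s := \max_(psi <- l) (g psi).+1.
have gs psi : F psi -> g psi < s.
  move=> /lF; rewrite /s; elim: (l) => [|x q IH] //= [->|/IH H].
    by rewrite big_cons leq_max leqnn.
  by rewrite big_cons leq_max H orbT.
pose R (a : nat * nat * 'I_m -> U) := exists y, forall i, In i (iota 0 s) ->
  sat (join y (fun v => a (i, f i, v))) phi.
have RA : definable set0 R.
  exact: (definable_jointly_sat (iota 0 s) (fun i v => (i, f i,
    v)) (definable_formula set0 phi)).
have /(aP _ RA)[y yP] : D R.
  (* [good] asks for a path bounded by [T0] everywhere, so [f] is truncated beyond the [s] rows that
     matter. *)
  pose f' i := if i < s then f i else 0.
  pose T0 := (\max_(i < s) f i).+1.
  have : D (good s T0) by apply: BD; exists s, T0.
  apply: filterS => b [_ /(_ f')] H.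
  have /H/jointly_sat_mkseq[y yP] : forall i, f' i < T0.
    move=> i; rewrite /f' /T0 ltnS; case: ifP => // si.
    exact: (leq_bigmax (Ordinal si)).
  exists y => i il; have := yP i il; rewrite /f'.
  by move: il => /In_mem; rewrite mem_iota add0n => /= ->.
exists y => psi Fpsi; rewrite (gP _ Fpsi); apply/holds_inst/yP/In_mem.
by rewrite mem_iota /= add0n gs.
Qed.

End Array.

Variable M : set U.
Hypothesis M_elem : elementary_substructure M.

Lemma finsat_base C : finsat M C set0.
Proof.
move=> V c _ R RM Rc; apply: (tarski_vaught M_elem _ Rc).
by apply: definable_sub RM => u [|[]].
Qed.

(* Q is a limit of the types of the terms of a coheir of the whole row. Hence
   each path through an array of copies of the row can be taken to be a Morley
   sequence of Q, and NTP2 applies to this array. *)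
Lemma dividing_coheir n m (phi : formula L ('I_n + 'I_m)) (c : 'I_m -> U) k
    (row : nat -> 'I_m -> U) :
  (forall t, same_type M (row t) c) -> k_inconsistent k phi row ->
  exists2 Q : set (set ('I_m -> U)), [/\ UltraFilter Q,
    concentrated M Q & realizes_ultra Q M c] &
    exists s, forall l, size l = s -> morley Q M l -> ~ jointly_sat (fun a =>
      sat a phi) l.
Proof.
move=> row_c row_inc; have [W uW Wnp] := nonprincipal_ultra.
pose rowt (x : nat * 'I_m) := row x.1 x.2.
have [|D uD [cD Drow]] := finsat_ultra (c := rowt) (@finsat_base (range rowt)).
  by move=> x; right; exists x.
pose Q : set (set ('I_m -> U)) :=
  [set R | W [set t | D [set d | R (fun j => d (t, j))]]].
have uQ : UltraFilter Q.
  apply: ultraI => [|A]; last first.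
    have [|WC] := in_ultra_setVsetC [set t | D [set d | A (fun j => d (t, j))]]
      uW.
      by left.
    right; suff : W [set t | D [set d | ~ A (fun j => d (t, j))]] by [].
    apply: filterS WC => t nDt.
    by have [//|] := in_ultra_setVsetC [set d | A (fun j => d (t, j))] uD.
  apply: Build_ProperFilter_ex => [A QA|].
    have [t At] := filter_ex (QA : W _); have [d Ad] := filter_ex (At : D _).
    by exists (fun j => d (t, j)).
  split=> [|A B QA QB|A B AB QA].
  - suff : W [set t | D setT] by [].
    by apply: filterS filterT => t _; apply: filterT.
  - suff : W [set t | D [set d | (A `&` B) (fun j => d (t, j))]] by [].
    apply: filterS (filterI (QA : W _) (QB : W _)) => t [At Bt].
    exact: filterI (At : D _) (Bt : D _).
  - suff : W [set t | D [set d | B (fun j => d (t, j))]] by [].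
    apply: filterS (QA : W _) => t At.
    by apply: filterS (At : D _) => d /AB.
have cQ : concentrated M Q.
  suff : W [set t | D [set d | forall j, M (d (t, j))]] by [].
  by apply: filterS filterT => t _; apply: filterS cD => d dM j; apply: dM.
exists Q.
  split=> // R RM QR; have [t Dt] := filter_ex (QR : W _); apply/(row_c t) =>
    //.
  apply: (Drow (fun d => R (fun j => d (t, j)))) => //.
  apply: (definable_comp (f := fun d j => d (t, j))) RM => [u ?|j];
    first by left.
  by left; exists (t, j).
apply: contrapT => noS.
have Qcon s : iterQ Q s (jointly_sat (fun a => sat a phi)).
  have [l [ls lQ lcon]] : exists l, [/\ size l = s,
    morley Q M l & jointly_sat (fun a => sat a phi) l].
    apply: contrapT => nl; apply: noS; exists s => l ls lQ lcon.
    by apply: nl; exists l.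
  have lM : ldefinable M (size l) (jointly_sat (fun a =>
    sat a phi)) by apply: ldefinable_jointly_sat; apply: definable_formula.
  by move: lcon; rewrite (morley_iterQ uQ cQ _ lQ lM) ?ls.
apply: (T_NTP2 U_T (phi := phi)); apply: (@array_TP2 _ _ k) => s T0.
(* The predicate is generalized because, once a row is chosen, the remaining rows have to satisfy
   the conjunction of its sections at the [T0] entries of that row. *)
elim: s (jointly_sat _) (Qcon s) => [|s IH] R.
  by move=> R0; exists (fun _ _ => c); split.
move=> /= QR.
(* [W] is nonprincipal, so the [T0] indices can be chosen distinct; k-inconsistency says nothing
   about repeated terms. *)
have [ts [ts_uniq ts_size tsP]] : exists ts : seq nat, [/\ uniq ts,
  size ts = T0 &
    forall t, t \in ts -> D [set d | iterQ Q s (fun l => R ((fun j => d (t,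
      j)) :: l))]].
  elim: (T0) => [|T1 [ts [ts_uniq ts_size tsP]]]; first by exists [::].
  have [t Dt tts] := Wnp _ ts QR; exists (t :: ts).
  split=> [||t']; rewrite /= ?tts ?ts_size // inE => /orP[/eqP->//|];
    exact: tsP.
have D1 : D [set d | forall t, In t ts -> iterQ Q s (fun l => R ((fun j =>
  d (t, j)) :: l))].
  apply: (@ultra_list _ _ uD _ ts (fun t d => iterQ Q s (fun l => R ((fun j =>
    d (t, j)) :: l)))).
  by move=> t /In_mem; apply: tsP.
have D2 : D [set d | forall i : {ffun 'I_k -> 'I_T0},
  In i (enum {: {ffun 'I_k -> 'I_T0}}) ->
    injective i -> ~ exists y, forall j, In j (enum 'I_k) ->
      sat (join y (fun v => d (nth 0 ts (i j), v))) phi].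
  apply: (@ultra_list _ _ uD _ _ (fun (i : {ffun 'I_k -> 'I_T0}) d =>
    injective i ->
    ~ exists y, forall j, In j (enum 'I_k) ->
      sat (join y (fun v => d (nth 0 ts (i j), v))) phi)) => i _.
  have [i_inj|ni] := pselect (injective i); last by apply: filterS filterT =>
    d _ /ni.
  have RA : definable (M `|` set0) (fun d : nat * 'I_m -> U =>
      ~ exists y, forall j, In j (enum 'I_k) ->
      sat (join y (fun v => d (nth 0 ts (i j), v))) phi).
    apply: definable_not.
    exact: (definable_jointly_sat (enum 'I_k) (fun j v => (nth 0 ts (i j),
      v)) (definable_formula _ phi)).
  suff H : ~ exists y, forall j, In j (enum 'I_k) ->
      sat (join y (fun v => rowt (nth 0 ts (i j), v))) phi.
    by apply: filterS ((realizes_ultra_iff uD Drow RA).1 H) => d.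
  move=> [y yP]; apply: (row_inc (fun j => nth 0 ts (i j))).
    move=> j j' /eqP; rewrite nth_uniq ?ts_size // => /eqP/val_inj;
      exact: i_inj.
  by exists y => j; apply/holds_inst/yP/In_mem; rewrite mem_enum.
(* One copy [d] of the whole row gives the next row of the array: k-inconsistent by [d2], and with
   every selected entry extendable by generic terms of [Q] by [d1]. *)
have [d [d1 d2]] := filter_ex (filterI D1 D2).
pose e i j := d (nth 0 ts i, j).
have /IH[r [r_inc rR]] : iterQ Q s (fun l => forall i, In i (iota 0 T0) ->
  R (e i :: l)).
  apply: iterQ_list => i /In_mem; rewrite mem_iota add0n => /= iT.
  by apply: d1; apply/In_mem/mem_nth; rewrite ts_size.
exists (fun i => if i is i'.+1 then r i' else e); split=> [[|i] si|f fT].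
- move=> i i_inj iT [y yP].
  apply: (d2 [ffun j => Ordinal (iT j)]).
  + by apply/In_mem; rewrite mem_enum.
  + by move=> j j'; rewrite !ffunE => /(congr1 val)/i_inj.
  + by exists y => j jl; rewrite ffunE; apply: yP.
- exact: r_inc.
- rewrite mkseq_cons; apply: (rR (fun i => f i.+1)) => //.
  by apply/In_mem; rewrite mem_iota add0n fT.
Qed.

End Kim.

(** * The broom lemma *)

Section MorleyMap.
Variables (L : language) (U : structure L).

Lemma morley_in V (Q : set (set (V -> U))) A l c :
  morley Q A l -> In c l -> realizes_ultra Q A c.
Proof.
elim: l => [|d l IH] //= [dQ lQ] [<-|/IH]; last exact.
by apply: realizes_ultra_sub dQ; left.
Qed.

Lemma morley_map V W (h : W -> V) (D : set (set (V -> U))) (Q : set (set (W ->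
  U))) A l :
  (forall S, Q S -> D [set x : V -> U | S (x \o h)]) -> morley D A l ->
  morley Q A [seq x \o h | x <- l].
Proof.
move=> QD; elim: l => [|c l IH] //= [cD /IH lQ]; split=> // R RA QR.
apply: (cD (fun x => R (x \o h))); last exact: QD.
apply: (definable_comp (f := fun x => x \o h)) RA => [u [Au|]|v];
  [by left| |by left; exists (h v)].
move=> [d /List.in_map_iff[x [<- xl]] [w _ <-]]; by right; exists x.
Qed.

Variable M : set U.
Hypothesis M_elem : elementary_substructure M.

(** Given an M-definable [R] containing [c] and [S] in [Q], the projection of [R] to the coordinates
    in the image of [h] belongs to [Q]. So some point of M lies in it and in [S], and Tarski-Vaught
    completes that point inside the fibre of [R]. *)
Lemma coheir_extension V W (h : W -> V) (Q : set (set (W -> U))) (c : V -> U) :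
  injective h -> UltraFilter Q -> concentrated M Q ->
    realizes_ultra Q M (c \o h) ->
  exists2 D : set (set (V -> U)), UltraFilter D &
    [/\ concentrated M D, realizes_ultra D M c & forall S, Q S ->
      D [set x : V -> U | S (x \o h)]].
Proof.
move=> h_inj uQ cQ hQ; have [m0 Mm0] := elem_pt M_elem.
pose g (z : W -> U) (x : V -> U) v := match pselect (exists w, h w = v) with
  | left e => z (sval (cid e)) | right _ => x v end.
have gh z x w : g z x (h w) = z w.
  rewrite /g; case: pselect => [e|[]]; last by exists w.
  by case: cid => w' /= /h_inj ->.
have gN z x v : ~ (exists w, h w = v) -> g z x v = x v by rewrite /g;
  case: pselect.
have key R S : definable M R -> R c -> Q S -> exists x, [/\ R x,
  S (x \o h) & forall v, M (x v)].
  move=> RM Rc QS; have [s sP] := definable_support RM.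
  pose l := [seq v <- s | `[< ~ (exists w, h w = v) >]].
  have lP v : In v l <-> In v s /\ ~ (exists w, h w = v).
    rewrite /l; elim: s {sP l} => [|u s IH] /=; first by split=> [|[]].
    case: asboolP => hu /=; rewrite IH.
      by split=> [[<-|[? ?]]|[[?|?] ?]]; tauto.
    by split=> [[? ?]|[[uu|?] ?]]; try tauto; subst u; tauto.
  (* The projection of [R]: only the finitely many relevant coordinates outside the image of [h] are
     quantified, and the irrelevant ones are set to [m0]. *)
  pose R' z := exists2 x, R x & forall v, ~ In v l -> x v = g z (fun=> m0) v.
  have R'M : definable M R'.
    apply: (definable_comp (f := fun z => g z (fun=>
      m0))) (definable_exl l RM) => // v.
    have [[w <-]|nv] := pselect (exists w, h w = v); first by left; exists w =>
      z; apply: gh.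
    by right; exists m0 => // z; apply: gN.
  have R'c : R' (c \o h).
    exists (fun v => if pselect (In v l) then c v else g (c \o h) (fun=> m0) v).
      apply: (iffLR (sP c _ _)) Rc => v vs; case: pselect => //= vl.
      have [[w <-]|nv] := pselect (exists w, h w = v); first by rewrite gh.
      by case: vl; apply/lP.
    by move=> v vl; case: pselect.
  have [z [[Sz [x Rx xz]] zM]] := filter_ex (filterI (filterI QS
    ((realizes_ultra_iff uQ hQ R'M).1 R'c)) cQ).
  have RgM : definable M (fun x => R (g z x)).
    apply: (definable_comp (f := g z)) RM => // v.
    have [[w <-]|nv] := pselect (exists w, h w = v).
      by right; exists (z w) => // y; apply: gh.
    by left; exists v => y; apply: gN.
  have Rgx : R (g z x).
    congr R: Rx; apply: funext => v.
    have [[w <-]|nv] := pselect (exists w, h w = v); last by rewrite gN.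
    by rewrite gh xz ?gh // => /lP[_ []]; exists w.
  have [x' x'M Rx'] := tarski_vaught M_elem RgM Rgx.
  exists (g z x'); split=> //; first by congr S: Sz; apply: funext => w;
    rewrite /= gh.
  move=> v; have [[w <-]|nv] := pselect (exists w, h w = v); last by rewrite gN.
  by rewrite gh.
have [|||D uD BD] := @ultra_base _ [set A | exists R S, [/\ definable M R, R c,
  Q S &
    A = [set x : V -> U | [/\ R x, S (x \o h) & forall v, M (x v)]]]].
- eexists; exists setT, setT; split; [exact: definable_True|by []|exact:
  filterT|reflexivity].
- move=> _ _ [R [S [RM Rc QS ->]]] [R' [S' [R'M R'c QS' ->]]].
  exists [set x : V -> U | [/\ (R `&` R') x, (S `&` S') (x \o h) & forall v,
    M (x v)]].
    by exists (R `&` R'), (S `&` S'); split=> //;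
      [exact: definable_and|exact: filterI].
  by move=> x [[Rx R'x] [Sx S'x] xM]; split.
- by move=> _ [R [S [RM Rc QS ->]]]; apply: key.
have BD' R S : definable M R -> R c -> Q S ->
    D [set x : V -> U | [/\ R x, S (x \o h) & forall v, M (x v)]].
  by move=> RM Rc QS; apply: BD; exists R, S.
exists D => //; split.
- by apply: filterS (BD' setT setT (definable_True _ _) Logic.I filterT) =>
  x [].
- apply: ultra_realizes => R RM Rc.
  by apply: filterS (BD' R setT RM Rc filterT) => x [].
- move=> S QS.
  by apply: filterS (BD' setT S (definable_True _ _) Logic.I QS) => x [].
Qed.

End MorleyMap.

Section Broom.
Variables (L : language) (T : theory L) (K : Type) (U : structure L).
Hypotheses (T_NTP2 : NTP2 T) (U_T : models U T).
Hypotheses (nat_small : small K nat) (U_sat : saturated K U).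
Variables (M : set U) (X : Type) (P : set (set (X -> U))).
Hypotheses (M_elem : elementary_substructure M) (M_small : small_set K M).
Hypotheses (X_small : small K X) (uP : UltraFilter P) (cP : concentrated M P).
Hypothesis P_indep : forall (a : X -> U) n (b : 'I_n -> U),
  realizes_ultra P M a -> indep M b a -> realizes_ultra P (M `|` range b) a.

Lemma finsat_nonforking C Y (b : Y -> U) (B : set U) : finsat M C B ->
  (forall v, (M `|` C) (b v)) -> ~ type_forks M (tp b (M `|` B)).
Proof.
move=> CB bC [psi [psiB b_psi] psi_forks].
have [D uD [cD bD]] := finsat_ultra CB bC.
apply: (inv_noforks uD (concentrated_inv uD cD) psi_forks).
exact: (realizes_ultra_iff uD bD (over_definable psiB)).1.
Qed.

(** A tuple of C is independent from [a], since coheirs do not fork; [P_indep] reverses this. It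
    suffices to treat the finite tuple of parameters of one formula. *)
Lemma realizes_ultra_fs a C : realizes_ultra P M a -> finsat M C (range a) ->
  realizes_ultra P (M `|` C) a.
Proof.
move=> aP CB R RC PR.
have [_ [n [psi [b [bC ->]]]] psiR] := definable_over RC; apply/psiR.
have aPb := P_indep aP (finsat_nonforking CB bC).
apply: (aPb (fun a => holds a (inst psi b))); last by apply: filterS PR =>
  x /psiR.
apply: over_definable; exists n, psi, b; split=> // i; right.
by exists i.
Qed.

Variables (n : nat) (alpha : ('I_n + X -> U) -> Prop).
Hypothesis alphaM : definable M alpha.

(** The [N] copies of [a] are bound by [iterQ] and thus range over M: no Morley sequence over the
    parameters of [psi] has to be chosen, and only the type of those parameters over M matters. *)
Definition forces N (psi : ('I_n -> U) -> Prop) := iterQ P N (fun l =>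
  forall y, (forall e, In e l -> alpha (join y e)) -> psi y).

(* theta(y, d) can be removed from any disjunction implied by alpha(y, a), at
   the price of replacing a by N independent realizations of P. *)
Definition negligible N W (theta : ('I_n + W -> U) -> Prop) (d0 : W -> U) :=
  forall a d C psi, realizes_ultra P M a -> same_type M d d0 -> small_set K C ->
  finsat M C (range a `|` range d) -> definable (M `|` C) psi ->
  (forall y, alpha (join y a) -> psi y \/ theta (join y d)) -> forces N psi.

(** One copy suffices: [a] realizes [P] over M and C, so the definable statement that [alpha(y, a)]
    implies [psi] passes to [P]. *)
Lemma negligible_False W (d0 : W -> U) : negligible 1 (fun=> False) d0.
Proof.
move=> a d C psi aP _ _ CB psiC imp.
have aPC : realizes_ultra P (M `|` C) a by apply: realizes_ultra_fs aP _;
  apply: finsat_sub CB => // u; left.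
pose R (x : X -> U) := ~ exists y, alpha (join y x) /\ ~ psi y.
have RC : definable (M `|` C) R.
  apply/definable_not/(definable_ex (R := fun b => alpha (join (fun i =>
    b (inr i)) (fun v => b (inl v)))
    /\ ~ psi (fun i => b (inr i)))).
  apply: definable_and.
    apply: (definable_comp (f := fun b => join (fun i => b (inr i)) (fun v =>
      b (inl v)))) alphaM.
      by move=> u; left.
    by move=> -[i|v]; left; eexists.
  apply: definable_not; apply: (definable_comp (f := fun b i =>
    b (inr i))) psiC => // i.
  by left; eexists.
have /(realizes_ultra_iff uP aPC RC) : R a by move=> [y [/imp[]]].
rewrite /forces /=; apply: filterS => x nR y yx; apply: contrapT => npsi;
  apply: nR; exists y; split=> //.
by apply: yx; left.
Qed.

Definition pair_range W (x : (X -> U) * (W -> U)) := range x.1 `|` range x.2.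

Definition seq_range W (l : seq ((X -> U) * (W -> U))) : set U :=
  [set u | exists2 x, In x l & pair_range x u].

Fixpoint finsat_chain W (l : seq ((X -> U) * (W -> U))) : Prop :=
  if l is x :: l' then finsat M (pair_range x) (seq_range l') /\
    finsat_chain l' else True.

(** The pairs are removed one at a time, at the price of [N] copies each; the chain condition
    supplies the finite satisfiability needed at every removal. *)
Lemma negligible_chain N W (theta : ('I_n + W -> U) -> Prop) d0
    (l : seq ((X -> U) * (W -> U))) C psi :
  small K W -> definable M theta -> negligible N theta d0 ->
  small_set K C -> definable (M `|` C) psi -> finsat M C (seq_range l) ->
    finsat_chain l ->
  (forall x, In x l -> realizes_ultra P M x.1 /\ same_type M x.2 d0) ->
  (forall y, (forall x, In x l -> alpha (join y x.1)) ->
     psi y \/ exists2 x, In x l & theta (join y x.2)) ->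
  forces (N * size l) psi.
Proof.
move=> W_small thetaM neg; elim: l C psi => [|x l IH]
  C psi C_small psiC Cl chain lP imp.
  by rewrite muln0 => y _; case: (imp y) => // [] [].
have [xP xd] := lP x (or_introl erefl).
have [xl lchain] := chain.
have Cx : small_set K (C `|` pair_range x).
  by do 2?[apply: small_set_setU => //]; apply: small_set_range.
(* The head pair is absorbed into [psi] as parameters while the tail is being removed. Once the tail
   has become tuples [l1] of M, these join [psi] in turn and the head is removed by [neg]. *)
pose psi' y := psi y \/ (theta (join y x.2) \/ ~ alpha (join y x.1)).
have psi'C : definable (M `|` (C `|` pair_range x)) psi'.
  apply: definable_or; first by apply: definable_sub psiC => u [?|?];
    [left|right; left].
  apply: definable_or.
    apply: (definable_comp (f := fun y => join y x.2)) thetaM => [u ?|[i|v]];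
      first by left.
      by left; exists i.
    by right; exists (x.2 v) => //; right; right; right; exists v.
  apply: definable_not.
  apply: (definable_comp (f := fun y => join y x.1)) alphaM => [u ?|[i|v]];
    first by left.
    by left; exists i.
  by right; exists (x.1 v) => //; right; right; left; exists v.
have /(IH _ _ Cx psi'C) H : finsat M (C `|` pair_range x) (seq_range l).
  apply: finsat_trans => //; apply: finsat_sub Cl => // u [xu|[y yl yu]].
    by exists x => //; left.
  by exists y => //; right.
have {H} : forces (N * size l) psi'.
  apply: H => // [y yl|y yl]; first by apply: lP; right.
  rewrite /psi'; have [ax|nax] := pselect (alpha (join y x.1)); last by left;
    right; right.
  case: (imp y) => [z [<-//|]|?|[z [<-|zl] yz]]; first exact: yl.
  - by left; left.
  - by left; right; left.
  - by right; exists z.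
rewrite mulnS addnC /forces -(iterQ_cat _ _ _ uP).
apply: (iterQ_conc uP cP) => l1 l1M _ l1P.
pose psi1 y := psi y \/ ~ (forall e, In e l1 -> alpha (join y e)).
have psi1C : definable (M `|` C) psi1.
  apply: definable_or => //; apply: definable_not; apply: definable_list =>
    e el.
  apply: (definable_comp (f := fun y => join y e)) alphaM => [u ?|[i|v]];
    first by left.
    by left; exists i.
  by right; exists (e v) => //; left; apply: l1M; exists e => //; exists v.
have : forces N psi1.
  apply: (neg x.1 x.2 C) => //.
    by apply: finsat_sub Cl => // u ux; exists x => //; left.
  move=> y ax; have [yl1|nyl1] := pselect (forall e, In e l1 ->
    alpha (join y e)).
    by case: (l1P y yl1) => [?|[?|//]]; [left; left|right].
  by left; right.
apply: iterQ_mono => // l2 l2P y yl.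
case: (l2P y) => [e el|//|nl1].
  by apply/yl/List.in_or_app; right.
by case: nl1 => e el; apply/yl/List.in_or_app; left.
Qed.

(** Along [s] conjugates of the data whose last components form a Morley sequence of [Q], the [phi]
    disjuncts cannot all hold. Hence the conjunction of the [alpha] implies [psi] or one of the
    [theta] disjuncts, and [negligible_chain] removes the latter. *)
Lemma negligible_or N W (theta : ('I_n + W -> U) -> Prop) (d0 : W -> U) m
    (phi : formula L ('I_n + 'I_m)) (c0 : 'I_m -> U) (Q : set (set ('I_m ->
      U))) s :
  small K W -> definable M theta -> negligible N theta d0 ->
  UltraFilter Q -> concentrated M Q -> realizes_ultra Q M c0 ->
  (forall l, size l = s -> morley Q M l -> ~ jointly_sat (fun a =>
    sat a phi) l) ->
  negligible (N * s) (fun z => theta (join (fun i => z (inl i)) (fun w =>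
    z (inr (inl w))))
     \/ sat (join (fun i => z (inl i)) (fun j =>
       z (inr (inr j)))) phi) (join d0 c0).
Proof.
move=> W_small thetaM neg uQ cQ c0Q Qinc a d C psi aP dd0 C_small CB psiC imp.
pose V := (X + (W + 'I_m))%type.
have V_small : small K V.
  by do 2!apply: (small_sum nat_small) => //; apply: small_fin.
pose e0 : V -> U := join a d.
pose h (j : 'I_m) : V := inr (inr j).
(* A Morley sequence of [D] conjugates [a] and [d] together, while its last components are a Morley
   sequence of [Q]. *)
have [||D uD [cD e0D QD]] := @coheir_extension _ U M M_elem V _ h Q e0 _ uQ cQ.
- by move=> j j' [].
- move=> R RM QR; have dR : definable M (fun x : W + 'I_m -> U => R (fun j =>
  x (inr j))).
    by apply: (definable_comp (f := fun x j => x (inr j))) RM => // j; left;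
      exists (inr j).
  by apply: ((dd0 _ dR).2); apply: c0Q.
have [l ls lD] := morley_exists nat_small U_sat s uD V_small M_small.
pose c : {u | C u} -> U := sval.
have [|CC uCC [cCC cE]] := finsat_ultra (c := c) CB; first by move=> v; right;
  apply: svalP.
(* The set C is replaced by a copy finitely satisfiable over the whole sequence [l], not only over
   [a] and [d]. *)
have [c' c'P] := realize nat_small U_sat uCC C_small
  (small_set_setU nat_small M_small (small_set_ranl nat_small l V_small)).
have le0 x : In x l -> same_type M x e0.
  move=> xl; apply: same_typeW => R RM; have xD := morley_in lD xl.
  by move/(realizes_ultra_iff uD xD RM)/(realizes_ultra_iff uD e0D RM).
have cc' : same_type M c c'.
  have H : realizes_ultra CC M c by apply: realizes_ultra_sub cE; left.
  have H' : realizes_ultra CC M c' by apply: realizes_ultra_sub c'P; left.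
  by apply: same_typeW => R RM /(realizes_ultra_iff uCC H
    RM)/(realizes_ultra_iff uCC H' RM).
have [psi0 psi0M psi0P] : exists2 psi0, definable M psi0 & forall y, psi y <->
  psi0 (join y c).
  apply: (definable_param (B := M `|` C)) psiC => u [Mu|Cu]; first by left.
  by right; exists (exist C u Cu).
pose G (z : V + {u | C u} -> U) := ~ exists y,
  alpha (join y (fun v => z (inl (inl v)))) /\
  ~ (psi0 (join y (fun u => z (inr u))) \/
     (theta (join y (fun w => z (inl (inr (inl w))))) \/
      sat (join y (fun j => z (inl (inr (inr j))))) phi)).
have GM : definable M G.
  apply/definable_not/(definable_ex (R := fun b =>
    alpha (join (fun i => b (inr i)) (fun v => b (inl (inl (inl v))))) /\
    ~ (psi0 (join (fun i => b (inr i)) (fun u => b (inl (inr u)))) \/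
     (theta (join (fun i => b (inr i)) (fun w =>
       b (inl (inl (inr (inl w)))))) \/
      sat (join (fun i => b (inr i)) (fun j =>
        b (inl (inl (inr (inr j)))))) phi)))).
  apply: definable_and.
    apply: (definable_comp (f := fun b => join (fun i => b (inr i))
      (fun v => b (inl (inl (inl v)))))) alphaM => // -[i|v]; left; by eexists.
  apply: definable_not; apply: definable_or.
    apply: (definable_comp (f := fun b => join (fun i => b (inr i))
      (fun u => b (inl (inr u))))) psi0M => // -[i|v]; left; by eexists.
  apply: definable_or.
    apply: (definable_comp (f := fun b => join (fun i => b (inr i))
      (fun w => b (inl (inl (inr (inl w))))))) thetaM => // -[i|v]; left;
        by eexists.
  apply: (definable_comp (f := fun b => join (fun i => b (inr i))
      (fun j => b (inl (inl (inr (inr j))))))) (definable_formula M phi) =>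
        // -[i|v]; left; by eexists.
have G0 : G (join e0 c).
  move=> [y [ay nH]]; case: nH; case: (imp y) => [|/psi0P|];
    [exact: ay|by left|by right].
(* For [z] in M the relation [G(_, z)] is over M and cannot distinguish [x] from [e0]; the coheir
   [CC] of C carries this over to [c']. *)
have Gl x : In x l -> G (join x c').
  move=> xl; apply: (c'P (fun z => G (join x z))).
    apply: (definable_comp (f := join x)) GM => [u ?|[v|u]]; first by left.
      by right; exists (x v) => //; right; exists x => //; exists v.
    by left; exists u.
  have GE : definable (M `|` (range a `|` range d)) (fun z => G (join e0 z)).
    apply: (definable_comp (f := join e0)) GM => [u ?|[[v|v]|u]]; first by left.
    - by right; exists (a v) => //; right; left; exists v.
    - by right; exists (d v) => //; right; right; exists v.
    - by left; exists u.
  have CG := (realizes_ultra_iff uCC cE GE).1 G0.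
  apply: filterS (filterI CG cCC) => z [/= Gz zM].
  have Hz : definable M (fun x => G (join x z)).
    apply: (definable_comp (f := fun x => join x z)) GM => // -[v|u];
      first by left; exists v.
    by right; exists (z u).
  exact/(le0 _ xl _ Hz).
pose psi' y := psi0 (join y c').
(* The tuples in [forces] come from M and [c'] has the type of [c] over M, so a conclusion about
   [c'] returns to [c]. *)
suff : forces (N * s) psi'.
  apply: (iterQ_conc uP cP) => q qM _ qP.
  have Hz : definable M (fun z => ~ exists y, (forall e, In e q ->
    alpha (join y e)) /\ ~ psi0 (join y z)).
    apply/definable_not/(definable_ex (R := fun b => (forall e, In e q ->
      alpha (join (fun i => b (inr i)) e)) /\
      ~ psi0 (join (fun i => b (inr i)) (fun v => b (inl v))))).
    apply: definable_and.
      apply: definable_list => e eq.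
      apply: (definable_comp (f := fun b => join (fun i =>
        b (inr i)) e)) alphaM => // -[i|v].
        by left; eexists.
      by right; exists (e v) => //; apply: qM; exists e => //; exists v.
    apply: definable_not; apply: (definable_comp (f := fun b => join (fun i =>
      b (inr i)) (fun v => b (inl v)))) psi0M => //.
    by move=> -[i|v]; left; eexists.
  have H : ~ exists y, (forall e, In e q -> alpha (join y e)) /\
    ~ psi0 (join y c).
    by apply/(cc' _ Hz) => -[y [/qP]].
  move=> y yq; apply/psi0P; apply: contrapT => nH; apply: H.
  by exists y.
pose l' := [seq ((fun v => x (inl v)) : X -> U, (fun w =>
  x (inr (inl w))) : W -> U) | x <- l].
have l'P z : In z l' -> exists2 x, In x l &
    z = (fun v => x (inl v), fun w => x (inr (inl w))).
  by move=> /List.in_map_iff[x [<- xl]]; exists x.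
have l'range q : seq_range [seq ((fun v => x (inl v)) : X -> U, (fun w =>
  x (inr (inl w))) : W -> U) | x <- q] `<=` ranl q.
  by move=> u [z /List.in_map_iff[x [<- xq]]] [] [v _ <-]; exists x.
have -> : s = size l' by rewrite size_map.
apply: (negligible_chain (C := range c') W_small thetaM neg).
- exact: small_set_range.
- apply: (definable_comp (f := fun y => join y c')) psi0M => [u ?|[i|v]];
  first by left.
    by left; exists i.
  by right; exists (c' v) => //; right; exists v.
- by apply: finsat_sub (finsat_realizes_ultra uCC cCC c'P); last exact: l'range.
- rewrite /l'; elim: (l) lD => [|x q IH] //= [xD /IH qD]; split=> //.
  apply: finsat_sub (finsat_realizes_ultra uD cD xD); last exact: l'range.
  move=> u [] [v _ <-]; first by exists (inl v).
  by exists (inr (inl v)).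
- move=> z /l'P[x xl ->] /=; split.
    move=> R RM PR; have RM' : definable M (fun x : V -> U => R (fun v =>
      x (inl v))).
      by apply: (definable_comp (f := fun x v => x (inl v))) RM => // v; left;
        exists (inl v).
    by apply: ((le0 _ xl _ RM').2); exact: (aP R RM PR).
  apply: same_typeW => R RM.
  have RM1 : definable M (fun x : W + 'I_m -> U => R (fun w => x (inl w))).
    by apply: (definable_comp (f := fun x w => x (inl w))) RM => // v; left;
      exists (inl v).
  have RM2 : definable M (fun x : V -> U => R (fun w => x (inr (inl w)))).
    by apply: (definable_comp (f := fun x w => x (inr (inl w)))) RM => // v;
      left; exists (inr (inl v)).
  by move=> /(le0 _ xl _ RM2)/(dd0 _ RM1).
(* If [y] avoided [psi'] and every [theta], it would satisfy [phi] at all [s] terms of a Morley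
   sequence of [Q], against the choice of [s]. *)
- move=> y yl; apply: contrapT => /not_orP[npsi ntheta].
  apply: (Qinc _ _ (morley_map (h := h) QD lD)); first by rewrite size_map.
  exists y => z /List.in_map_iff[x [<- xl]]; apply: contrapT => nphi.
  apply: (Gl x xl); exists y; split=> /=.
    by apply: (yl (fun v => x (inl v), fun w => x (inr (inl w))));
      apply/List.in_map_iff; exists x.
  move=> [//|[th|//]]; apply: ntheta; exists (fun v => x (inl v), fun w =>
    x (inr (inl w))) => //.
  by apply/List.in_map_iff; exists x.
Qed.

Lemma dividing_negligible (F : seq (lformula U 'I_n)) :
  (forall phi, In phi F -> divides M phi) ->
  exists N W (theta : ('I_n + W -> U) -> Prop) (d0 : W -> U),
    [/\ small K W, definable M theta, negligible N theta d0 &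
      forall y phi, In phi F -> holds y phi -> theta (join y d0)].
Proof.
elim: F => [|phi F IH] FP.
  exists 1, void, (fun=> False), (of_void U); split=> //;
    last exact: negligible_False.
    by apply: (small_inj (f := of_void nat)) => // -[].
  exact: definable_False.
have [|N [W [theta [d0 [W_small thetaM neg thP]]]]] := IH.
  by move=> psi psiF; apply: FP; right.
have [m [phi0 [c [phiE [k [row [row_c row_inc]]]]]]] :=
  FP phi (or_introl erefl).
have [Q [uQ cQ cQc] [s sP]] := dividing_coheir T_NTP2 U_T nat_small U_sat M_elem
  (fun t => (tp_eqP _ _ _).1 (row_c t)) row_inc.
have negl := negligible_or W_small thetaM neg uQ cQ cQc sP.
exists (N * s), (W + 'I_m)%type; do 2!eexists; split; last 2 first.
- exact: negl.
- move=> y psi [<-|psiF] yH; first by right; rewrite phiE in yH;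
  apply/holds_inst.
  by left; apply: thP yH.
- by apply: (small_sum nat_small) => //; apply: small_fin.
- apply: definable_or.
    apply: (definable_comp (f := fun z => join (fun i => z (inl i)) (fun w =>
      z (inr (inl w))))) thetaM => //.
    by move=> -[i|v]; left; eexists.
  apply: (definable_comp (f := fun z => join (fun i => z (inl i)) (fun j =>
    z (inr (inr j))))) (definable_formula M phi0) => //.
  by move=> -[i|v]; left; eexists.
Qed.

(** The elimination is run with C empty and [psi] false: when all dividing disjuncts are gone, [N]
    copies of [alpha] imply a contradiction. *)
Lemma forking_inconsistent a (F : set (lformula U 'I_n)) : realizes_ultra P M a
  ->
  finite_set F -> F `<=` divides M ->
  (forall y, alpha (join y a) -> exists2 phi, F phi & holds y phi) ->
  exists N, iterQ P N (fun l => ~ jointly_sat alpha l).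
Proof.
move=> aP /finite_list[l lF] Fd imp.
have [|N [W [theta [d0 [W_small thetaM neg thP]]]]] := @dividing_negligible l.
  by move=> phi /lF /Fd.
exists N; have : forces N (fun=> False).
  apply: (neg a d0 set0) => //; first exact: small_set_set0.
  - exact: finsat_set0.
  - exact: definable_False.
  - by move=> y /imp[phi /lF phil yphi]; right; apply: thP yphi.
by apply: iterQ_mono => // q H [y /H].
Qed.

End Broom.

(** * Generically stable types *)

Section Uniform.
Variables (L : language) (U : structure L).

(** Invariance and dividing are phrased with finite parameter tuples; [r] selects the finitely many
    entries, from [w] or from B, that [G] really uses. The point [u0] keeps that list nonempty. *)
Lemma definable_uniform V W (B : set U) (G : (V + W -> U) -> Prop) u0 : B u0 ->
  definable B G ->
  exists n (r : 'I_n -> W + {u | B u}) (psi : formula L (V + 'I_n)),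
    forall x w, G (join x w) <-> sat (join x (join w sval \o r)) psi.
Proof.
move=> Bu0 [phi phiP]; have [s sP] := sat_support U phi.
pose q : seq (W + {u | B u}) := inr (exist B u0 Bu0) :: pmap (fun z =>
  match z with
  | inl (inl v) => None | inl (inr w) => Some (inl w) | inr u =>
    Some (inr u) end) s.
pose r (i : 'I_(size q)) := nth (inr (exist B u0 Bu0)) q i.
have rP z : In z q -> exists i, r i = z.
  move=> zq; suff [i iq iz] : exists2 i, i < size q & nth (inr (exist B u0
    Bu0)) q i = z.
    by exists (Ordinal iq).
  elim: (q) zq => [|z' q' IH] //= [->|/IH[i iq iz]]; first by exists 0.
  by exists i.+1.
have /choice[k kP] (z : V + W + {u | B u}) : exists z' : V + 'I_(size q),
    In z s -> forall x w, join (join x w) sval z = join x (join w sval \o r) z'.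
  case: z => [[v|w]|u]; first by exists (inl v).
    have [ws|] := pselect (In (inl (inr w)) s); last by exists (inr ord0).
    have [|i iE] := rP (inl w); last by exists (inr i) => _ x w' /=; rewrite iE.
    right; elim: s ws {sP q r rP} => [|z s IH] //= [->|/IH]; first by left.
    by case: z => [[v|w']|u] //=; right.
  have [us|] := pselect (In (inr u) s); last by exists (inr ord0).
  have [|i iE] := rP (inr u); last by exists (inr i) => _ x w' /=; rewrite iE.
  right; elim: s us {sP q r rP} => [|z s IH] //= [->|/IH]; first by left.
  by case: z => [[v|w']|u'] //=; right.
exists (size q), r, (rename k phi) => x w; rewrite phiP sat_rename.
by apply: sP => z zs; rewrite (kP z zs).
Qed.

Lemma inv_definable X W (M B : set U) (P : set (set (X -> U))) (G : (X + W ->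
  U) -> Prop)
    (w w' : W -> U) u0 :
  M u0 -> M `<=` B -> ultra_invariant M P -> definable B G ->
    same_type B w w' ->
  P [set x | G (join x w)] -> P [set x | G (join x w')].
Proof.
move=> Mu0 MB iP GB ww'; have [n [r [psi psiP]]] :=
  definable_uniform (MB _ Mu0) GB.
have E w0 : [set x | G (join x w0)] = [set x | sat (join x (join w0 sval \o r))
  psi].
  by apply/seteqP; split=> x /=; rewrite psiP.
rewrite !E; apply: iP => R RM.
have RB : definable B (fun w : W -> U => R (join w sval \o r)).
  apply: (definable_comp (f := fun w => join w sval \o r)) RM => // i /=.
  case: (r i) => [v|[u Bu]]; first by left; exists v.
  by right; exists u.
exact: (ww' _ RB).
Qed.

End Uniform.

Section Stable.
Variables (L : language) (K : Type) (U : structure L).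
Hypotheses (nat_small : small K nat) (U_sat : saturated K U).
Variables (M : set U) (X : Type) (p : set (lformula U X)) (P : set (set (X ->
  U))).
Hypotheses (M_elem : elementary_substructure M) (M_small : small_set K M).
Hypotheses (X_small : small K X) (uP : UltraFilter P) (iP : ultra_invariant M
  P).
Hypothesis pP : forall phi, p phi <-> P [set a | holds a phi].
Hypothesis avP : forall I (lt : I -> I -> Prop), strict_well_order lt ->
  infinite_set [set: I] ->
  forall a : I -> X -> U, morley_sequence M p lt a -> is_type setT (Av a).

Definition omega_morley A (a : nat -> X -> U) := forall i,
  realizes_ultra P (A `|` [set u | exists2 j, j < i & range (a j) u]) (a i).

Lemma omega_morley_exists A : small_set K A -> exists a, omega_morley A a.
Proof.
move=> A_small.
have /choice[f fP] (l : seq (X -> U)) : exists c,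
  realizes_ultra P (A `|` ranl l) c.
  apply: (realize nat_small U_sat uP X_small).
  exact: (small_set_setU nat_small A_small (small_set_ranl nat_small l
    X_small)).
pose l := fix l i := if i is i'.+1 then f (l i') :: l i' else [::].
exists (fun i => f (l i)) => i; apply: realizes_ultra_sub (fP (l i)) =>
  u [Au|[j ji uj]]; first by left.
right; elim: i ji => // i IH; rewrite ltnS leq_eqVlt =>
  /orP[/eqP ji|/IH[c cl uc]].
  by exists (f (l j)) => //; left; rewrite ji.
by exists c => //; right.
Qed.

Lemma omega_morley_list A a (s : seq nat) : omega_morley A a ->
  path.sorted (fun i j => j < i) s -> morley P A [seq a i | i <- s].
Proof.
move=> aP; elim: s => [|i s IH] //= is_path; split;
  last exact/IH/(path_sorted is_path).
apply: realizes_ultra_sub (aP i) => u [?|[c /List.in_map_iff[j [<- js]] cu]];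
  first by left.
right; exists j => //.
have tr : transitive (fun i j : nat => j < i) by move=> x y z xy yz;
  apply: ltn_trans yz xy.
by move: is_path; rewrite (path_sortedE tr) => /andP[/allP + _]; apply;
  apply/In_mem.
Qed.

Lemma omega_morley_rev A a n : omega_morley A a ->
  morley P A [seq a i | i <- rev (iota 0 n)].
Proof.
move=> aP; apply: omega_morley_list => //.
by rewrite rev_sorted iota_ltn_sorted.
Qed.

(** [P] is only invariant here, so [morley_iterQ] does not apply. By induction the tails have the
    same type over B, and invariance then compares the types of the heads over them. *)
Lemma morley_unique B l l' R : M `<=` B -> size l = size l' ->
  morley P B l -> morley P B l' -> ldefinable B (size l) R -> R l <-> R l'.
Proof.
have [u0 Mu0] := elem_pt M_elem.
move=> MB; elim: l l' R => [|c l IH] [|c' l'] R //= [ll'] [cP lP] [cP' lP'] RB.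
pose x0 : X -> U := fun=> u0.
pose W := (nat * X)%type.
pose e (q : seq (X -> U)) : W -> U := fun iv => nth x0 q iv.1 iv.2.
pose f (z : X + W -> U) (iv : nat * X) :=
  if iv.1 is i.+1 then z (inr (i, iv.2)) else z (inl iv.2).
pose G (z : X + W -> U) := R (mkseq (fun i v => f z (i, v)) (size l).+1).
have GB : definable B G.
  apply: (definable_comp (f := f)) RB => // -[[|i] v]; left;
    first by exists (inl v).
  by exists (inr (i, v)).
have GE x q : size q = size l -> G (join x (e q)) = R (x :: q).
  by move=> qs; rewrite /G mkseq_cons -qs /f /= -[q in RHS](mkseq_nth x0).
have ee' : same_type B (e l) (e l').
  move=> S SB; pose S' q := S (e q).
  have S'B : ldefinable B (size l) S'.
    apply: (definable_comp (f := fun a : nat * X -> U => e (mkseq (fun i v =>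
      a (i, v)) (size l)))) SB => // -[i v].
    rewrite /e; have [il|il] := ltnP i (size l).
      by left; exists (i, v) => a; rewrite nth_mkseq.
    by right; exists u0; [exact: MB|move=> a; rewrite nth_default ?size_mkseq].
  exact: (IH l' S').
have RE q d : size q = size l -> morley P B q ->
  realizes_ultra P (B `|` ranl q) d ->
    R (d :: q) <-> P [set x | G (join x (e q))].
  move=> qs qP dP; have RqB : definable (B `|` ranl q) (fun x => R (x :: q)).
    by apply: ldefinable_head RB.
  rewrite (realizes_ultra_iff uP dP RqB).
  by split; apply: filterS => x /=; rewrite GE.
rewrite (RE l c) // (RE l' c') //; split;
  apply: (inv_definable Mu0 MB iP GB) => //.
exact: same_type_sym.
Qed.

(** The order type omega + omega. *)
Definition lex_lt (x y : nat + nat) := match x, y with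
  | inl i, inl j => i < j | inl _, inr _ => true
  | inr _, inl _ => false | inr i, inr j => i < j end.

Lemma lex_lt_swo : strict_well_order lex_lt.
Proof.
have accl i : Acc lex_lt (inl i).
  elim/ltn_ind: i => i IH; apply: Acc_intro; case=> j; [exact: IH|discriminate].
split.
- move=> [i|i]; first exact: accl.
  elim/ltn_ind: i => i IH; apply: Acc_intro; case=> j; [move=> _;
    exact: accl|exact: IH].
- by move=> [i|i] [j|j] [k|k] //=; apply: ltn_trans.
- move=> [i|i] [j|j] /=; [|by constructor 1|by constructor 3|];
    by case: (ltngtP i j) => [|| ->]; [constructor 1|constructor 3|constructor
      2].
Qed.

(* Otherwise some b' = b over B satisfies R with all terms of a Morley
   omega-sequence; continue it by a Morley sequence over b' to a Morley
   sequence of length omega + omega, whose average type is not complete. *)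
Lemma stable_finish B m (b : 'I_m -> U) (R : ('I_m + X -> U) -> Prop) :
  small_set K B -> M `<=` B -> definable B R -> P [set x | ~ R (join b x)] ->
  exists2 theta : ('I_m -> U) -> Prop, definable B theta /\ theta b &
    exists N, forall l, size l = N -> morley P B l ->
      ~ jointly_sat (fun z => theta (fun i => z (inl i)) /\ R z) l.
Proof.
move=> B_small MB RB PnR; apply: contrapT => nfin.
have [u0 Mu0] := elem_pt M_elem.
have [a aP] := omega_morley_exists B_small.
have acon theta N : definable B theta -> theta b ->
    jointly_sat (fun z => theta (fun i => z (inl i)) /\
      R z) [seq a i | i <- rev (iota 0 N)].
  move=> thB thb; have [l [lN lP lcon]] : exists l, [/\ size l = N,
    morley P B l &
      jointly_sat (fun z => theta (fun i => z (inl i)) /\ R z) l].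
    apply: contrapT => nl; apply: nfin; exists theta => //; exists N =>
      l lN lP lcon.
    by apply: nl; exists l.
  move: lcon; have H : ldefinable B (size l) (jointly_sat (fun z =>
    theta (fun i => z (inl i)) /\ R z)).
    apply: ldefinable_jointly_sat; apply: definable_and => //.
    by apply: (definable_comp (f := fun z i => z (inl i))) thB => // i; left;
      exists (inl i).
  apply: (iffLR (morley_unique MB _ lP (omega_morley_rev N aP) H)).
  by rewrite size_map size_rev size_iota.
(* The type of [b] over B together with all [R(y, a_i)]; its finite parts are consistent by
   [acon]. *)
have [|||D uD BD] := @ultra_base _ [set A | exists theta N, [/\
  definable B theta, theta b &
    A = [set y | theta y /\ forall i, i < N -> R (join y (a i))]]].
- by eexists; exists setT, 0; split; [exact: definable_True|by []|reflexivity].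
- move=> _ _ [th [N [thB thb ->]]] [th' [N' [thB' thb' ->]]].
  exists [set y | (th `&` th') y /\ forall i, i < maxn N N' ->
    R (join y (a i))].
    by exists (th `&` th'), (maxn N N'); split=> //; apply: definable_and.
  by move=> y [[thy thy'] yR]; split; split=> // i iN; apply: yR;
    rewrite leq_max iN ?orbT.
(* With [N.+1] terms the list is nonempty, so [th y] is available even when N is 0. *)
- move=> _ [th [N [thB thb ->]]]; have [y yP] := acon th N.+1 thB thb.
  have aN i : i < N.+1 -> In (a i) [seq a i | i <- rev (iota 0 N.+1)].
    by move=> iN; apply/List.in_map/In_mem; rewrite mem_rev mem_iota.
  exists y; split; first by have [] := yP (a 0) (aN 0 isT).
  by move=> i iN; have [] := yP (a i) (aN i (leqW iN)).
pose B1 := B `|` range (fun x : X * nat => a x.2 x.1).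
have B1_small : small_set K B1.
  apply: (small_set_setU nat_small B_small); apply: small_set_range;
    exact: small_prod_nat.
have [b' b'P] := realize nat_small U_sat uD (small_fin nat_small m) B1_small.
have bb' : same_type B b b'.
  apply: same_typeW => S SB Sb; apply: b'P.
    by apply: definable_sub SB; left.
  by apply: filterS (BD _ (ex_intro _ S (ex_intro _ 0 (And3 SB Sb erefl)))) =>
    y [].
have Rb' i : R (join b' (a i)).
  apply: (b'P (fun y => R (join y (a i)))).
    apply: (definable_comp (f := fun y => join y (a i))) RB => [u|[j|x]];
      first by left.
      by left; exists j.
    by right; exists (a i x) => //; right; exists (x, i).
  have := BD _ (ex_intro _ setT (ex_intro _ i.+1 (And3 (definable_True _ _)
    Logic.I erefl))).
  by apply: filterS => y [_]; apply.
have [a' a'P] := omega_morley_exists (small_set_setU nat_small B1_small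
  (small_set_range b' (small_fin nat_small m))).
have PnR' : P [set x | ~ R (join b' x)].
  pose sw (z : X + 'I_m -> U) := join (fun i => z (inr i)) (fun v => z (inl v)).
  have GB : definable B (fun z => ~ R (sw z)).
    apply: definable_not; apply: (definable_comp (f := sw)) RB => // -[i|v];
      left; by eexists.
  exact: (inv_definable Mu0 MB iP GB bb').
have nRb' i : ~ R (join b' (a' i)).
  apply: (a'P i (fun x => ~ R (join b' x))) => //.
  apply: definable_not; apply: (definable_comp (f := fun x => join b' x)) RB =>
    [u Bu|[j|x]].
  - by left; left; left.
  - by right; exists (b' j) => //; left; right; exists j.
  - by left; exists x.
have morl : morley_sequence M p lex_lt (fun x => match x with inl i =>
  a i | inr i => a' i end).
  move=> [i|i] phi [/pP Pphi /over_definable phiA].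
    apply: (aP i _ _ Pphi); apply: definable_sub phiA => u [/MB|];
      first by left.
    by move=> [[j|j] //= ji uj]; right; exists j.
  apply: (a'P i _ _ Pphi); apply: definable_sub phiA => u [/MB|];
    first by left; left; left.
  move=> [[j|j] /= ji uj]; last by right; exists j.
  by left; left; right; have [x _ <-] := uj; exists (x, j).
have inf_sum (f : nat -> nat + nat) (A : set (nat + nat)) : injective f ->
    (forall i, A (f i)) -> ~ finite_set A.
  move=> f_inj fA finA; apply: infinite_nat.
  have : finite_set (range f) by apply: sub_finite_set finA => _ [i _ <-].
  by rewrite (eq_finite_set (inj_card_eq _)) // => x y _ _; apply: f_inj.
have inl_inj : injective (@inl nat nat) by move=> i j [].
have inr_inj : injective (@inr nat nat) by move=> i j [].
have [_ _ compl] := avP lex_lt_swo (inf_sum inl setT inl_inj (fun=>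
  Logic.I)) morl.
have /definable_over[phi _ phiR] : definable (B `|` range b') (fun x =>
  R (join b' x)).
  apply: (definable_comp (f := fun x => join b' x)) RB => [u|[j|x]];
    first by left.
    by right; exists (b' j) => //; right; exists j.
  by left; exists x.
case: (compl phi (over_setT phi)); apply/inf_sum.
- exact: inr_inj.
- by move=> i /= /phiR; apply: nRb'.
- exact: inl_inj.
- by move=> i /=; apply; apply/phiR.
Qed.

(** Let [R'] hold at [b1] and [a] although [P] contains its negation over [b1]. By [stable_finish]
    some [theta] of the type of [b1] makes [theta] and [R'] together inconsistent along N terms of
    any Morley sequence over B, and such terms are conjugates of [a]. *)
Lemma stable_symmetry B (a : X -> U) Y (b : Y -> U) : small_set K B ->
  M `<=` B ->
  realizes_ultra P B a -> ~ realizes_ultra P (B `|` range b) a ->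
  exists psi : lformula U Y, [/\ Defs.over (B `|` range a) psi,
    holds b psi & divides M psi].
Proof.
move=> B_small MB aB na; have [u0 Mu0] := elem_pt M_elem.
have [R [Rb PR nRa]] : exists R, [/\ definable (B `|` range b) R, P R & ~ R a].
  apply: contrapT => nR; apply: na => R Rb PR; apply: contrapT => nRa.
  by apply: nR; exists R.
have [_ [n [psi0 [b1 [b1b ->]]]] psi0R] := definable_over Rb.
have psi0E x : R x <-> sat (join x b1) psi0 by rewrite -psi0R holds_inst.
pose R' (z : 'I_n + X -> U) := ~ sat (join (fun v => z (inr v)) (fun i =>
  z (inl i))) psi0.
have R'B : definable B R'.
  apply: definable_not.
  apply: (definable_comp (f := fun z => join (fun v => z (inr v)) (fun i =>
    z (inl i)))) (definable_formula B psi0) => //.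
  by move=> -[i|v]; left; eexists.
have [|theta [thB thb] [N thN]] := stable_finish (b := b1) B_small MB R'B.
  by apply: filterS PR => x /psi0E xP; apply.
have /choice[h hP] i : exists z : Y + {u | B u}, b1 i = join b sval z.
  case: (b1b i) => [Bi|[y _ yi]]; first by exists (inr (exist B _ Bi)).
  by exists (inl y).
pose f (y : Y -> U) i := join y sval (h i).
have fb : f b = b1 by apply: funext => i; rewrite /f hP.
pose chi (z : Y + X -> U) := theta (f (fun y => z (inl y))) /\
  R' (join (f (fun y => z (inl y))) (fun v => z (inr v))).
have chiB : definable B chi.
  apply: definable_and.
    apply: (definable_comp (f := fun z => f (fun y => z (inl y)))) thB => // i;
      rewrite /f.
    case: (h i) => [y|[u Bu]]; first by left; exists (inl y).
    by right; exists u.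
  apply: (definable_comp (f := fun z => join (f (fun y => z (inl y))) (fun v =>
    z (inr v)))) R'B => //.
  move=> -[i|v]; last by left; exists (inr v).
  rewrite /f /=; case: (h i) => [y|[u Bu]]; first by left; exists (inl y).
  by right; exists u.
have [k [r [psi psiP]]] := definable_uniform (MB _ Mu0) chiB.
exists (inst psi (join a sval \o r)); split.
- exists k, psi, (join a sval \o r); split=> // i /=.
  by case: (r i) => [v|[u Bu]]; [right; exists v|left].
- apply/holds_inst/psiP; rewrite /chi /= fb; split=> //.
  by move=> /psi0E.
have [c cP] := omega_morley_exists B_small.
exists k, psi, (join a sval \o r); split=> //; exists N, (fun t =>
  join (c t) sval \o r).
split.
  move=> t; apply/tp_eqP => S SM.
  have SB : definable B (fun x : X -> U => S (join x sval \o r)).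
    apply: (definable_comp (f := fun x => join x sval \o r)) SM => // i /=.
    case: (r i) => [v|[u Bu]]; first by left; exists v.
    by right; exists u.
  have ctB : realizes_ultra P B (c t) by apply: realizes_ultra_sub (cP t); left.
  by rewrite (realizes_ultra_iff uP ctB SB) (realizes_ultra_iff uP aB SB).
move=> i i_inj [y yP].
(* The indices come in any order, while Morley lists have their last term first: hence the
   decreasing sort. *)
pose s := rev (sort leq (codom i)).
have s_sorted : path.sorted (fun x y => y < x) s.
  rewrite rev_sorted ltn_sorted_uniq_leq sort_uniq sort_sorted ?andbT.
    exact/injectiveP.
  exact: leq_total.
apply: (thN [seq c t | t <- s]).
- by rewrite size_map size_rev size_sort size_codom card_ord.
- exact: omega_morley_list.
exists (f y) => _ /List.in_map_iff[t [<- /In_mem]]; rewrite mem_rev mem_sort =>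
  /codomP[j ->].
have /holds_inst/psiP := yP j.
by [].
Qed.

Lemma stable_indep (a : X -> U) Y (b : Y -> U) : realizes_ultra P M a ->
  indep M b a -> indep M a b.
Proof.
move=> aM ba.
have ab : realizes_ultra P (M `|` range b) a.
  apply: contrapT => /(stable_symmetry M_small (fun=>
    id) aM)[psi [psiM b_psi psi_div]].
  apply: ba; exists psi => //; exists [set psi]; split=> //; first by move=>
    _ ->.
  by move=> y; exists psi.
move=> [psi [psiM a_psi] psi_forks]; apply: (inv_noforks uP iP psi_forks).
exact: (realizes_ultra_iff uP ab (over_definable psiM)).1.
Qed.

(** Since lists start with the last term, [rcons] inserts [c] in front of the sequence. *)
Lemma morley_rcons A l c : morley P (A `|` range c) l -> realizes_ultra P A c ->
  morley P A (rcons l c).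
Proof.
elim: l => [_ cA|e l IH] /=; first by split=> //;
  apply: realizes_ultra_sub cA => u [|[]].
move=> [eP lP] cA; split; last exact: IH.
apply: realizes_ultra_sub eP => u [Au|[d dl ud]]; first by left; left.
have [dc|dl'] : d = c \/ In d l.
  elim: l dl {IH lP} => [|d' l IH] /= [->|]; [by left|by []|by right; left|].
  by move/IH => [->|?]; [left|right; right].
  by left; right; rewrite -dc.
by right; exists d.
Qed.

(** If [phi] is in [q] and not in [p], [stable_finish] bounds by some N the length of Morley
    sequences of [P] all of whose terms satisfy [phi]; realizations of [q] nevertheless build one of
    length N. *)
Lemma stable_stationary : is_type setT p -> weakly_stationary M p.
Proof.
move=> p_type; split.
  move=> [psi /pP Ppsi psi_forks]; exact: (inv_noforks uP iP psi_forks).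
move=> q q_type pq q_nf; have [Q uQ qQ] := type_ultra q_type.
have QP c : realizes_ultra Q M c -> realizes_ultra P M c.
  move=> cQ R RM PR; apply: cQ => //.
  have [phi phiM phiR] := definable_over RM.
  have /qQ : q phi.
    by apply: pq; split=> //; apply/pP; apply: filterS PR => x /phiR.
  by apply: filterS => x /phiR.
suff sub phi : q phi -> p phi.
  apply/seteqP; split=> // phi p_phi; apply/qQ; apply: contrapT =>
    /(ultraN uQ) nQ.
  have /sub/pP nP : q (Neg phi) by apply/qQ.
  by move/pP: p_phi => Pphi; have [x [nx /nx]] := filter_ex (filterI nP Pphi).
move=> q_phi; apply/pP; apply: contrapT => /(ultraN uP) nPphi.
have [m [psi [b0 [_ phiE]]]] := over_setT phi.
pose R (z : 'I_m + X -> U) := sat (join (fun v => z (inr v)) (fun i =>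
  z (inl i))) psi.
have RM : definable M R.
  apply: (definable_comp (f := fun z => join (fun v => z (inr v)) (fun i =>
    z (inl i)))) (definable_formula M psi) => //.
  by move=> -[i|v]; left; eexists.
have phiR x : holds x phi <-> R (join b0 x) by rewrite phiE holds_inst.
have [|theta [thM thb] [N thN]] := stable_finish (b := b0) M_small (fun=>
  id) RM.
  by apply: filterS nPphi => x nx /phiR.
have [l [lN lP lR]] : exists l, [/\ size l = N, morley P M l &
    forall e, In e l -> R (join b0 e)].
  (* The new term [c] realizes [q] over [b0] and [l], so it satisfies [phi]; it can be placed in
     front once [l] is known to be Morley over [c] as well. *)
  elim: (N) => [|k [l [lk lP lR]]]; first by exists [::].
  have [c cP] := realize nat_small U_sat uQ X_small
    (small_set_setU nat_small (small_set_setU nat_small M_small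
      (small_set_range b0 (small_fin nat_small m)))
       (small_set_ranl nat_small l X_small)).
  exists (rcons l c); split; first by rewrite size_rcons lk.
    apply: morley_rcons; last by apply: QP; apply: realizes_ultra_sub cP =>
      u Mu; left; left.
    have {cP} : realizes_ultra Q (M `|` ranl l) c by apply: realizes_ultra_sub
      cP => u [?|?]; [left; left|right].
    elim: l lP {lk lR} => [|e l IH] //= [eP lP] cP; split; last first.
      by apply: IH => //; apply: realizes_ultra_sub cP => u [|[d dl du]];
        [left|right; exists d => //; right].
    (* If [e] were not generic over [c], symmetry over M and the earlier terms would put a formula
       dividing over M into [q]. *)
    apply: contrapT => ne; have [|||psi' [psi'M c_psi' psi'_div]] :=
        @stable_symmetry (M `|` ranl l) e X c _ _ eP.
    - exact: small_set_setU (small_set_ranl nat_small l X_small).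
    - by left.
    - by move=> H; apply: ne; apply: realizes_ultra_sub H => u [[?|?]|?];
      [left; left|right|left; right].
    apply: q_nf; exists psi'.
      apply/qQ; apply: (realizes_ultra_iff uQ cP _).1 c_psi'.
      apply: definable_sub (over_definable psi'M) => u [[?|[d dl du]]|eu];
        first by left.
        by right; exists d => //; right.
      by right; exists e => //; left.
    by exists [set psi']; split=> //; [move=> _ ->|move=> y; exists psi'].
  have Rc : R (join b0 c).
    apply: (cP (fun x => R (join b0 x))).
      apply: (definable_comp (f := fun x => join b0 x)) RM => [u ?|[i|v]];
        first by left; left.
        by right; exists (b0 i) => //; left; right; exists i.
      by left; exists v.
    by move/qQ: q_phi; apply: filterS => x /phiR.
  move=> e; elim: (l) lR => [|d l' IH] /= lR; first by case=> // <-.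
  case=> [<-|]; first by apply: lR; left.
  by apply: IH => e' e'l; apply: lR; right.
by case: (thN l lN lP); exists b0 => e /lR.
Qed.

End Stable.

(** * Stationary types with symmetry *)

(** Repeatedly take the least element of A not yet chosen. This reduces Morley sequences of any
    infinite order type to omega. *)
Lemma increasing_sequence I (lt : I -> I -> Prop) (A : set I) :
  strict_well_order lt -> ~ finite_set A ->
  exists2 s : nat -> I, forall i, A (s i) & forall i j, i < j -> lt (s i) (s j).
Proof.
move=> [wf _ tri] infA.
have /choice[f fP] (l : seq I) : exists i, [/\ A i, ~ In i l &
    forall j, A j -> ~ In j l -> i = j \/ lt i j].
  have [i0 [Ai0 i0l]] : exists i, A i /\ ~ In i l.
    apply: contrapT => nA; apply: infA.
    apply: (@sub_finite_set _ _ [set i | In i l]) => [i Ai|].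
      by apply: contrapT => il; apply: nA; exists i.
    elim: (l) => [|i q IH]; first by apply: sub_finite_set (finite_set0 I) =>
      i [].
    apply: (@sub_finite_set _ _ ([set i] `|` [set i | In i q])).
      by move=> j [->|?]; [left|right].
    by rewrite finite_setU; split=> //; apply: finite_set1.
  elim/(well_founded_ind wf): i0 Ai0 i0l => i IH Ai il.
  have [[j [Aj jl ji]]|nj] := pselect (exists j, [/\ A j, ~ In j l & lt j i]).
    exact: (IH j).
  exists i; split=> // j Aj jl; case: (tri i j) => [?|->|?];
    [by right|by left|].
  by case: nj; exists j.
pose l := fix l i := if i is i'.+1 then f (l i') :: l i' else [::].
exists (fun i => f (l i)) => [i|i j ij]; first by have [] := fP (l i).
have lS : forall k, In k (l i) -> In k (l j).
  elim: j ij => // j IH; rewrite ltnS leq_eqVlt => /orP[/eqP <-|/IH H] k kl;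
    right=> //.
  exact: H.
have ilj : In (f (l i)) (l j).
  elim: j ij {lS} => // j IH; rewrite ltnS leq_eqVlt => /orP[/eqP <-|/IH];
    first by left.
  by right.
have [_ _ /(_ (f (l j)))] := fP (l i).
have [Aj jl _] := fP (l j).
by case=> // [/lS//|ij']; case: jl; rewrite -ij'.
Qed.

Section Stationary.
Variables (L : language) (U : structure L) (M : set U) (X : Type).
Variable p : set (lformula U X).
Hypotheses (M_elem : elementary_substructure M) (p_type : is_type setT p).
Hypothesis p_stat : weakly_stationary M p.

Lemma stationary_coheir : exists2 P : set (set (X -> U)), UltraFilter P /\
  concentrated M P &
  forall phi, p phi <-> P [set a | holds a phi].
Proof.
have [D uD pD] := type_ultra p_type.
have [|||P uP BP] := @ultra_base _ [set A | exists R,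
    [/\ definable M R, D R & A = R `&` [set a : X -> U | forall v, M (a v)]]].
- by eexists; exists setT; split; [exact: definable_True|exact:
  filterT|reflexivity].
- move=> _ _ [R [RM DR ->]] [R' [RM' DR' ->]].
  exists ((R `&` R') `&` [set a | forall v, M (a v)]).
    by exists (R `&` R'); split=> //; [apply: definable_and|apply: filterI].
  by move=> a [[]].
- move=> _ [R [RM DR ->]]; have [a Ra] := filter_ex DR.
  by have [m] := tarski_vaught M_elem RM Ra; exists m.
have cP : concentrated M P.
  by apply: filterS (BP _ (ex_intro _ setT (And3 (definable_True _ _) filterT
    erefl))) => a [].
exists P => //.
suff -> : p = [set phi | P [set a | holds a phi]] by [].
apply/esym; apply: p_stat.2; first exact: ultra_type.
  move=> phi [p_phi phiM].
  by apply: filterS (BP _ (ex_intro _ _ (And3 (over_definable phiM) ((pD phi).1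
    p_phi) erefl))) => a [].
move=> [psi Ppsi psi_forks].
exact: (inv_noforks uP (concentrated_inv uP cP) psi_forks).
Qed.

(** The type of [a] over M and [b] has a global extension that does not fork over M; it extends p|M,
    so it is [p] by stationarity. *)
Lemma stationary_realizes Y (P : set (set (X -> U))) (a : X -> U) (b : Y -> U) :
  UltraFilter P -> (forall phi, p phi <-> P [set a | holds a phi]) ->
  realizes_ultra P M a -> indep M a b -> realizes_ultra P (M `|` range b) a.
Proof.
move=> uP pP aM ab; have [D [uD aD] Dnf] := nonforking_tp_ultra ab.
have Dp : [set phi | D [set a | holds a phi]] = p.
  apply: p_stat.2; first exact: ultra_type.
    move=> phi [/pP Pphi /over_definable phiM].
    have phiMb : definable (M `|` range b) (fun a => holds a phi).
      by apply: definable_sub phiM; left.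
    exact: (realizes_ultra_iff uD aD phiMb).1 (aM _ phiM Pphi).
  by move=> [psi Dpsi /Dnf].
move=> R Rb PR; have [phi phib phiR] := definable_over Rb.
apply: (aD _ Rb); have /pP : P [set a | holds a phi] by apply: filterS PR =>
  x /phiR.
by rewrite -Dp; apply: filterS => x /phiR.
Qed.

End Stationary.

Section SymmetryAverage.
Variables (L : language) (T : theory L) (K : Type) (U : structure L).
Hypotheses (T_NTP2 : NTP2 T) (U_T : models U T).
Hypotheses (nat_small : small K nat) (U_sat : saturated K U).
Variables (M : set U) (X : Type) (P : set (set (X -> U))).
Hypotheses (M_elem : elementary_substructure M) (M_small : small_set K M).
Hypotheses (X_small : small K X) (uP : UltraFilter P) (cP : concentrated M P).
Hypothesis P_indep : forall (a : X -> U) n (b : 'I_n -> U),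
  realizes_ultra P M a -> indep M b a -> realizes_ultra P (M `|` range b) a.

Lemma omega_morley_limit (c : nat -> X ->
  U) n (psi : formula L (X + 'I_n)) (b : 'I_n -> U) :
  omega_morley P M c -> (forall i, sat (join (c i) b) psi) ->
  P [set x | ~ sat (join x b) psi] -> False.
Proof.
move=> cM c_psi Pnpsi.
have c0M : realizes_ultra P M (c 0) by apply: realizes_ultra_sub (cM 0); left.
pose sw (z : 'I_n + X -> U) := join (fun v => z (inr v)) (fun i => z (inl i)).
have swM : definable M (fun z => sat (sw z) psi).
  by apply: (definable_comp (f := sw)) (definable_formula M psi) => // -[i|v];
    left; eexists.
have [|||D [uD BD] Dnf] := @nonforking_ultra _ U M 'I_n [set A | exists theta,
    [/\ definable M theta, theta b & A = [set y | theta y /\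
      sat (join (c 0) y) psi]]].
- by eexists; exists setT; split; [exact: definable_True|by []|reflexivity].
- move=> _ _ [th [thM thb ->]] [th' [thM' thb' ->]].
  exists [set y | (th `&` th') y /\ sat (join (c 0) y) psi].
    by exists (th `&` th'); split=> //; apply: definable_and.
  by move=> y [[]].
- move=> _ F [th [thM thb ->]] finF Fd; apply: contrapT => nF.
  (* If dividing formulas covered [alpha(y, c 0)], the broom lemma would make [alpha] inconsistent
     along N terms; but [b] satisfies [alpha] along all of [c]. *)
  pose alpha (z : 'I_n + X -> U) := th (fun i => z (inl i)) /\ sat (sw z) psi.
  have alphaM : definable M alpha.
    apply: definable_and => //.
    by apply: (definable_comp (f := fun z i => z (inl i))) thM => // i; left;
      exists (inl i).
  have [|N PN] := forking_inconsistent T_NTP2 U_T nat_small U_sat M_elem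
    M_small X_small uP cP
    P_indep alphaM c0M finF Fd.
    move=> y ay; apply: contrapT => nphi; apply: nF; exists y =>
      // phi Fphi yphi.
    by apply: nphi; exists phi.
  have lM := omega_morley_rev N cM.
  have lcon : jointly_sat alpha [seq c i | i <- rev (iota 0 N)].
    by exists b => _ /List.in_map_iff[i [<- _]]; split=> //; apply: c_psi.
  have := (morley_iterQ uP cP _ lM (ldefinable_jointly_sat _ alphaM)).1 lcon.
  rewrite size_map size_rev size_iota => /(_ (fun=> id)) Pcon.
  apply: (@iterQ_False _ U _ P N uP).
  by apply: iterQ_mono (iterQ_and uP PN Pcon) => // l [].
have [b' b'D] := realize nat_small U_sat uD (small_fin nat_small n)
  (small_set_setU nat_small M_small (small_set_range (c 0) X_small)).
have bb' : same_type M b b'.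
  apply: same_typeW => S SM Sb; apply: b'D; first by apply: definable_sub SM;
    left.
  by apply: filterS (BD _ (ex_intro _ S (And3 SM Sb erefl))) => y [].
have psi_b' : sat (join (c 0) b') psi.
  apply: (b'D (fun y => sat (join (c 0) y) psi)).
    apply: (definable_comp (f := fun y =>
      join (c 0) y)) (definable_formula (M `|` range (c 0)) psi) => // -[v|i].
      by right; exists (c 0 v) => //; right; exists v.
    by left; exists i.
  by apply: filterS (BD _ (ex_intro _ setT (And3 (definable_True _ _) Logic.I
    erefl))) => y [].
have b'c0 : indep M b' (c 0).
  move=> [chi [chiM b'_chi] chi_forks]; apply: (Dnf _ chi_forks).
  exact: (realizes_ultra_iff uD b'D (over_definable chiM)).1.
have c0b' := P_indep c0M b'c0.
apply: (c0b' (fun x => ~ sat (join x b') psi)) => //.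
  apply: definable_not; apply: (definable_comp (f := fun x =>
    join x b')) (definable_formula (M `|` range b') psi) => // -[v|i].
    by left; exists v.
  by right; exists (b' i) => //; right; exists i.
have := concentrated_inv uP cP (phi := Neg psi) bb'.
exact.
Qed.

Lemma average_type (p : set (lformula U X)) I (lt : I -> I -> Prop) (a : I ->
  X -> U) :
  is_type setT p -> (forall phi, p phi <-> P [set a | holds a phi]) ->
  strict_well_order lt -> infinite_set [set: I] -> morley_sequence M p lt a ->
  is_type setT (Av a).
Proof.
move=> p_type pP swo infI a_morley.
(* Otherwise an increasing omega-subsequence satisfies [phi] throughout. It is again a Morley
   sequence, since each of its terms has fewer predecessors than before. *)
have key phi : P [set x | ~ holds x phi] ->
  finite_set [set i | holds (a i) phi].
  move=> Pn; apply: contrapT => inf_phi.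
  have [s sphi s_lt] := increasing_sequence swo inf_phi.
  have [n [psi [b [_ phiE]]]] := over_setT phi.
  apply: (@omega_morley_limit (a \o s) n psi b).
  - move=> i R RM PR; have [chi chiM chiR] := definable_over RM.
    have Pchi : P [set x | holds x chi] by apply: filterS PR => x /chiR.
    have /definable_over[chi' chi'M chi'R]
      : definable (M `|` [set u | exists2 j, lt j (s i) & range (a j) u]) R.
      apply: definable_sub RM => u [?|[j ji uj]]; first by left.
      by right; exists (s j) => //; apply: s_lt.
    apply/chi'R; apply: (a_morley (s i)); split=> //.
    by apply/pP; apply: filterS PR => x /chi'R.
  - by move=> i; apply/holds_inst; rewrite -phiE; apply: sphi.
  - by apply: filterS Pn => x nx /holds_inst; rewrite -phiE.
split=> [phi _|F /finite_list[l lF] FAv|phi _]; first exact: over_setT.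
- have fin : finite_set [set i | exists2 phi, In phi l & holds (a i) (Neg phi)].
    have : forall phi, In phi l -> Av a phi by move=> phi /lF /FAv.
    elim: (l) => [|phi q IH] qAv.
      by apply: sub_finite_set (finite_set0 I) => i [].
    apply: (@sub_finite_set _ _ ([set i | holds (a i) (Neg phi)] `|`
        [set i | exists2 phi, In phi q & holds (a i) (Neg phi)])).
      by move=> i [psi [<-|psiq] ni]; [left|right; exists psi].
    rewrite finite_setU; split; first by apply: qAv; left.
    by apply: IH => psi psiq; apply: qAv; right.
  have [i ni] : exists i, ~ exists2 phi, In phi l & holds (a i) (Neg phi).
    apply: contrapT => nall; apply: infI; apply: sub_finite_set fin => i _.
    by apply: contrapT => ni; apply: nall; exists i.
  exists (a i) => phi Fphi; apply: contrapT => nphi; apply: ni.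
  by exists phi => //; apply/lF.
- have [Pphi|Pnphi] := in_ultra_setVsetC [set x | holds x phi] uP.
    left; apply: key; apply: filterS Pphi => x xphi nx; exact: nx xphi.
  right; apply: sub_finite_set (key phi Pnphi) => i /=.
  by move=> nn; apply: contrapT => n; apply: nn.
Qed.

End SymmetryAverage.

Theorem theorem3p10 (L : language) (T : theory L) (K : Type) (U : structure L)
    (T_complete : complete_theory T) (T_NTP2 : NTP2 T)
    (U_monster : monster K T U)
    (X : Type) (X_small : small K X)
    (p : set (lformula U X)) (p_type : is_type setT p)
    (M : set U) (M_elementary : elementary_substructure M)
    (M_small : small K {u | M u}) :
  generically_stable M p <->
  weakly_stationary M p /\
  (forall a : X -> U, realizes a (restr p M) ->
   forall (Y : Type) (b : Y -> U), small K Y -> indep M b a -> indep M a b).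
Proof.
have [[nat_small _ _] U_T U_sat _] := U_monster.
have realizes_realizes_ultra P a : (forall phi, p phi <->
  P [set x | holds x phi]) ->
    UltraFilter P -> realizes a (restr p M) <-> realizes_ultra P M a.
  move=> pP uP; split=> [ap R RM PR|aP phi [/pP Pphi /over_definable phiM]];
    last exact: (aP _ phiM Pphi).
  have [phi phiM phiR] := definable_over RM; apply/phiR/ap; split=> //.
  by apply/pP; apply: filterS PR => x /phiR.
split=> [[p_inv p_av]|[p_stat p_sym]].
  have [P uP pP] := type_ultra p_type.
  have iP : ultra_invariant M P.
    move=> n phi b b' bb' Pb.
    have /p_inv/iffLR H : tp b M = tp b' M by apply/tp_eqP.
    have /H/pP : p (inst phi b) by apply/pP; apply: filterS Pb => x /holds_inst.
    by apply: filterS => x /holds_inst.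
  split; first exact: (stable_stationary nat_small U_sat M_elementary M_small
    X_small uP iP pP p_av).
  move=> a /(realizes_realizes_ultra _ _ pP uP) aM Y b _.
  exact: (stable_indep nat_small U_sat M_elementary M_small X_small uP iP pP
    p_av aM).
have [P [uP cP] pP] := stationary_coheir M_elementary p_type p_stat.
(* Both halves of (ii) meet here: symmetry turns [indep M b a] around, and stationarity identifies
   the type of [a] over M and [b]. *)
have P_indep (a : X -> U) n (b : 'I_n -> U) :
    realizes_ultra P M a -> indep M b a -> realizes_ultra P (M `|` range b) a.
  move=> aM ba; apply: (stationary_realizes p_stat uP pP aM).
  by apply: p_sym ba; [apply/(realizes_realizes_ultra _ _ pP uP)|apply:
    small_fin].
split.
  move=> n phi b b' bb'.
  have bM : same_type M b b' by apply/tp_eqP.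
  have E c : p (inst phi c) <-> P [set x | sat (join x c) phi].
    by rewrite pP; split; apply: filterS => x /holds_inst.
  rewrite !E; split; first exact: (concentrated_inv uP cP bM).
  exact: (concentrated_inv uP cP (same_type_sym bM)).
move=> I lt swo infI a.
exact: (average_type T_NTP2 U_T nat_small U_sat M_elementary M_small X_small uP
  cP P_indep).
Qed.
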